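(* For $n\ge 1$ let $a_n$ be the number of simple-2-column polyominoes with exactly $n$ hexagonal cells (counted up to translation). Then the growth constant $\mu=\lim_{n\to\infty}a_n^{1/n}$ exists, satisfies $\mu=\sup_{n\ge1}a_n^{1/n}$, and $$\mu>4.294676 .$$
   Context: Consider the regular hexagonal tiling of the Euclidean plane, oriented so that every hexagonal tile (cell) has two horizontal edges. A polyomino is a plane figure which is a (nonempty) union of finitely many cells and whose interior is connected. Two polyominoes are considered equal if and only if one is a translate of the other. The cells of a polyomino $P$ are partitioned according to their horizontal projection (two cells are in the same block iff they have the same projection onto the horizontal axis, i.e. lie in the same vertical stack of hexagons); each block is called a column of $P$. A column need not be connected; its connected components are the connected components of the union of its cells (maximal runs of vertically consecutive cells). A column is a one-component (resp. two-component) column if it has exactly one (resp. exactly two) connected components. A 2-column polyomino is a polyomino each of whose columns has either one or two connected components. A simple-2-column polyomino is a 2-column polyomino in which no two consecutive (horizontally neighbouring) columns are both two-component columns. *)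

(* Defs.v *)
From HB Require Import structures.
From mathcomp Require Import all_boot all_order all_algebra finmap.
From mathcomp Require Import all_classical all_reals all_analysis.

Import Order.TTheory GRing.Theory Num.Theory.
Import numFieldNormedType.Exports.

Local Open Scope classical_set_scope.
Local Open Scope ring_scope.

(* The tile [(x, y)] is the [y]-th one in the [x]-th vertical stack.  The tiles
   have side length 1, hence height [sqrt 3], and two neighbouring stacks are
   at horizontal distance 3/2 and shifted vertically by half a tile; so the six
   neighbours of [(x, y)] are [(x, y + 1)], [(x, y - 1)], [(x + 1, y)],
   [(x + 1, y - 1)], [(x - 1, y)] and [(x - 1, y + 1)]. *)
Definition cell_center (R : realType) (c : int * int) : R * R :=
  (3 / 2 * c.1%:~R, Num.sqrt 3 * (c.2%:~R + c.1%:~R / 2)).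

(* The closed regular hexagon centred at [cell_center R c] whose vertices are,
   with respect to the centre, (1, 0), (-1, 0) and (+-1/2, +-sqrt 3 / 2). *)
Definition cell (R : realType) (c : int * int) : set (R * R) :=
  [set p | let u : R := p.1 - (cell_center R c).1 in
           let v : R := p.2 - (cell_center R c).2 in
           `|v| <= Num.sqrt 3 / 2 /\ Num.sqrt 3 * `|u| + `|v| <= Num.sqrt 3].

Definition figure (R : realType) (P : {fset int * int}) : set (R * R) :=
  \bigcup_(c in [set` P]) cell R c.

(* A polyomino is represented by the finite set of its cells. *)
Definition polyomino (R : realType) (P : {fset int * int}) : Prop :=
  P != fset0 /\ connected (interior (figure R P)).

Definition translates (R : realType) (P : {fset int * int}) :
    set {fset int * int} :=
  [set Q | exists v : R * R, figure R Q = [set p + v | p in figure R P]].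

(* The horizontal projection of [cell R c] is the segment of length 2 centred at
   [3 / 2 * c.1]: two cells have the same one iff they have the same [c.1]. *)
Definition column (P : {fset int * int}) (x : int) : set (int * int) :=
  [set c | c \in P /\ c.1 = x].

(* The connected components of column [x], as the pairs (lowest row, highest
   row) of its maximal runs of vertically consecutive cells. *)
Definition components (P : {fset int * int}) (x : int) : set (int * int) :=
  [set r | [/\ r.1 <= r.2,
               (forall y : int, r.1 <= y <= r.2 -> column P x (x, y)),
               ~ column P x (x, r.1 - 1) &
               ~ column P x (x, r.2 + 1)]].

Definition one_component_column (P : {fset int * int}) (x : int) : Prop :=
  (components P x #= `I_1)%card.

Definition two_component_column (P : {fset int * int}) (x : int) : Prop :=
  (components P x #= `I_2)%card.

Definition two_column_polyomino (R : realType) (P : {fset int * int}) : Prop :=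
  polyomino R P /\
  forall x : int, column P x !=set0 ->
    one_component_column P x \/ two_component_column P x.

Definition simple_two_column_polyomino (R : realType) (P : {fset int * int}) :
    Prop :=
  two_column_polyomino R P /\
  forall x : int, ~ (two_component_column P x /\ two_component_column P (x + 1)).

Definition simple_two_column_classes (R : realType) (n : nat) :
    set (set {fset int * int}) :=
  [set translates R P | P in
    [set P | simple_two_column_polyomino R P /\ #|` P| = n]].

(* [fset_set] of an infinite set is empty, so this is the number of classes
   because there are finitely many of them. *)
Definition nb_simple_two_column (R : realType) (n : nat) : nat :=
  #|` fset_set (simple_two_column_classes R n)|.

Definition nth_root_count (R : realType) (n : nat) : R :=
  (nb_simple_two_column R n)%:R `^ (n%:R)^-1.

(* Main.v *)
Require Import Defs.
From Stdlib Require Import NArith.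
From HB Require Import structures.
From mathcomp Require Import all_boot all_order all_algebra finmap.
From mathcomp Require Import all_classical all_reals all_analysis.
From mathcomp Require Import zify ring lra.

Import Order.TTheory GRing.Theory Num.Theory.
Import numFieldNormedType.Exports.

(** Read from left to right, the columns of a simple-2-column polyomino form a
word whose letters are runs of cells and pairs of runs separated by a gap, each
letter placed relative to the previous one.  Since no two consecutive letters
are pairs, connectedness is a local condition, [completes]: consecutive columns
touch, and each two-component column has a neighbour that touches both of its
runs.  The number of admissible positions of a letter depends only on lengths
and gaps: runs of k and l cells in neighbouring stacks touch in k + l positions,
and a run of k cells touches both runs around a gap g in k - g positions (for
g < k).  Hence the number [rest k n] of ways to add n cells to a word ending
with a run of k cells obeys the recursion [restE], and the number of polyominoes
with n cells is the explicit number [total n] ([nb_simple_two_columnE]).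

Convergence of the n-th roots to their supremum is Fekete's lemma
([root_seq_cvg_sup]), which needs an exponential upper bound ([total_upper]) and
supermultiplicativity ([total_supermultiplicative]).  Concatenation does not
give the latter at once, because two two-component columns cannot be put side by
side.  However, every word X of area m has at least [total n] completions by n
cells.  If X ends with a one-component column, then any word can be put behind
it.  If X ends with a two-component column, then the words that start with a
two-component column are lost, but each of the others fits in at least four
positions; this compensates the loss because at most three quarters of the words
start with a two-component column ([two_start_le]).  The reason for that
estimate is that such a word goes on with a run longer than the gap, whereas the
number of words starting with a one-component column at least triples with each
additional cell ([one_start_grows]).

For the lower bound, the recursion of [rest] is truncated to runs of at most
seven cells next to two-component columns whose runs and gap have at most four.
A positive vector that the truncated recursion does not decrease when a cell has
weight 10 / 43 ([profile_subinvariant]) shows that [rest k n] is at least a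
constant times (43 / 10)^n.  So the growth constant is at least 4.3.

On the geometric side, tiles that meet are equal or neighbours, so a figure with
connected interior has a connected set of tiles; conversely the segments from the
points of the interior to the centres of their tiles, and between the centres of
neighbouring tiles, stay in the interior ([polyominoP]).  A translation between
two figures maps leftmost vertices to leftmost vertices, so its vector is a
difference of two tile centres ([translatesP]). *)

(** * The numbers of words *)

(** The number of completions by [n] cells after a two-component column with gap
[g] and [s] cells, if [h l m] is the number of completions by [m] cells after a
run of [l] cells.  A run of [l] cells touches both components in [l - g]
positions, and at least one of them in [2 * l + s - (l - g)]; [pend] means that
the column on the left does not touch both, so that the column on the right
has to. *)
Definition two_count (h : nat -> nat -> nat) (pend : bool) (s g n : nat) : nat :=
  (~~ pend && (n == 0)) +
  \sum_(1 <= l < n.+1) (if pend then l - g else 2 * l + s - (l - g)) * h l (n - l).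

(** The number of completions by [n] cells after a run of [k] cells: none, a run of
[l] cells, or runs of [i] and [j] cells around a gap [g].  In the last case both
runs are touched in [k - g] positions, and exactly one in
[2 * k + (i + j) - 2 * (k - g)].  If the gap is at least [n + k], then neither
the given run nor a later one touches both sides of it. *)
Definition one_count (h : nat -> nat -> nat) (k n : nat) : nat :=
  (n == 0) + \sum_(1 <= l < n.+1) (k + l) * h l (n - l) +
  \sum_(1 <= i < n.+1) \sum_(1 <= j < (n - i).+1) \sum_(1 <= g < n + k)
    ((k - g) * two_count h false (i + j) g (n - i - j) +
     (2 * k + (i + j) - 2 * (k - g)) * two_count h true (i + j) g (n - i - j)).

(** The recursive calls of [one_count] are at smaller values of [n], so that [n] is
enough fuel. *)
Fixpoint fuel_count (f k n : nat) : nat :=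
  if f is f'.+1 then one_count (fuel_count f') k n else n == 0.

Definition rest (k n : nat) : nat := fuel_count n k n.

Lemma eq_two_count h h' pend s g n :
  (forall l m, m < n -> h l m = h' l m) ->
  two_count h pend s g n = two_count h' pend s g n.
Proof.
move=> hh'; congr addn; apply: eq_big_nat => l /andP[l0 ln].
by rewrite hh' //; lia.
Qed.

Lemma eq_one_count h h' k n :
  (forall l m, m < n -> h l m = h' l m) -> one_count h k n = one_count h' k n.
Proof.
move=> hh'; congr (_ + _ + _).
  by apply: eq_big_nat => l /andP[l0 ln]; rewrite hh' //; lia.
apply: eq_big_nat => i /andP[i0 i_n]; apply: eq_big_nat => j /andP[j0 jn].
apply: eq_bigr => g _.
by rewrite !(@eq_two_count h h') // => l m mn; apply: hh'; lia.
Qed.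

Lemma one_count0 h k : one_count h k 0 = 1.
Proof. by rewrite /one_count !big_geq. Qed.

Lemma fuel_count_indep f f' k n : n <= f -> n <= f' -> fuel_count f k n = fuel_count f' k n.
Proof.
elim: f f' n k => [|f IH] [|f'] [|n] k //; rewrite /= ?one_count0 //.
by move=> nf nf'; apply: eq_one_count => l m mn; apply: IH; lia.
Qed.

Lemma restE k n : rest k n = one_count rest k n.
Proof.
case: n => [|n]; first by rewrite one_count0.
by apply: eq_one_count => l m mn; apply: fuel_count_indep; lia.
Qed.

Lemma rest0 k : rest k 0 = 1.
Proof. by []. Qed.

Definition one_start n := \sum_(1 <= l < n.+1) rest l (n - l).
(** A first column has no neighbour on the left, hence [pend] is true. *)
Definition two_start n :=
  \sum_(1 <= i < n.+1) \sum_(1 <= j < (n - i).+1) \sum_(1 <= g < n.+1)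
    two_count rest true (i + j) g (n - i - j).

Lemma two_true_false s g n :
  two_count rest true s g n <= two_count rest false s g n.
Proof.
rewrite /two_count add0n; apply: leq_trans (leq_addl _ _).
by apply: leq_sum => l _; rewrite leq_mul2r; apply/orP; right; lia.
Qed.

(** The next run is longer than the gap. *)
Lemma two_true0 s g n : n <= g -> two_count rest true s g n = 0.
Proof.
move=> ng; rewrite /two_count /= add0n big_nat big1 // => l /andP[l0 ln].
by rewrite (_ : l - g = 0) //; lia.
Qed.

Lemma leq_sum_range (F : nat -> nat) a b c :
  b <= c -> \sum_(a <= i < b) F i <= \sum_(a <= i < c) F i.
Proof.
move=> bc; have [ab|/ltnW ba] := leqP a b; last by rewrite big_geq.
by rewrite [leqRHS](@big_cat_nat _ _ _ b) ?leq_addr // ltnW.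
Qed.

Lemma leq_sum_nat_r (F G : nat -> nat) a b :
  (forall i, a <= i < b -> F i <= G i) ->
  \sum_(a <= i < b) F i <= \sum_(a <= i < b) G i.
Proof. by move=> FG; rewrite big_nat [leqRHS]big_nat; apply: leq_sum. Qed.

(** Lengthening a run preserves its contacts. *)
Lemma rest_mono k k' n : k <= k' -> rest k n <= rest k' n.
Proof.
move=> kk'; rewrite !restE /one_count.
apply: leq_add; first apply: leq_add => //.
  by apply: leq_sum => l _; rewrite leq_mul2r; apply/orP; right; lia.
apply: leq_sum => i _; apply: leq_sum => j _.
apply: (@leq_trans (\sum_(1 <= g < n + k)
  ((k' - g) * two_count rest false (i + j) g (n - i - j) +
   (2 * k' + (i + j) - 2 * (k' - g)) *
     two_count rest true (i + j) g (n - i - j)))).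
  by apply: leq_sum => g _; apply: leq_add; rewrite leq_mul2r;
    apply/orP; right; lia.
by apply: leq_sum_range; lia.
Qed.

(** A cell can be added on top of the first column, or as a new first column in at
least two positions. *)
Lemma one_start_grows n : 3 * one_start n <= one_start n.+1.
Proof.
rewrite {2}/one_start big_nat_recl // -[3]/(2 + 1) mulnDl mul1n.
apply: leq_add.
  rewrite subn1 /= restE /one_count -addnA addnCA.
  apply: leq_trans (leq_addr _ _).
  rewrite /one_start big_distrr /=; apply: leq_sum_nat_r => l /andP[l0 _].
  by rewrite leq_mul2r; apply/orP; right; lia.
rewrite big_add1 /one_start big_add1 /=.
by apply: leq_sum_nat_r => l _; rewrite subSS rest_mono.
Qed.

Lemma rest1_le n : rest 1 n <= one_start n.+1.
Proof. by rewrite /one_start big_nat_recl // subn1 leq_addr. Qed.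

Lemma gap_sum l N : 2 * \sum_(1 <= g < N) (l - g) <= l * l.-1.
Proof.
have [N0|] := posnP N; first by rewrite N0 big_geq.
case: N => // N _.
suff: 2 * \sum_(1 <= g < N.+1) (l - g) + (l - N) * (l - N).-1 = l * l.-1.
  by move=> <-; rewrite leq_addr.
elim: N => [|N IH]; first by rewrite big_geq // subn0.
rewrite big_nat_recr //= -IH mulnDr -!addnA; congr addn.
have [H|H] := leqP l N.+1; last by nia.
rewrite (_ : l - N.+1 = 0); last by lia.
by have [->|->] : l - N = 0 \/ l - N = 1 by lia.
Qed.

Lemma two_false_le s g n : 1 < s -> two_count rest false s g n <= s * rest 1 n.
Proof.
move=> s1; rewrite restE /one_count mulnDr.
apply: leq_trans (leq_addr _ _); rewrite mulnDr.
apply: leq_add; first by case: (n == 0); rewrite //= ?muln1; lia.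
rewrite big_distrr /=; apply: leq_sum_nat_r => l /andP[l0 _].
by rewrite mulnA leq_mul2r; apply/orP; right; nia.
Qed.

(** A run of [k] cells is compared with a single cell, which has at least 1 / k
times as many positions next to any column, except that it never touches both
runs of a two-component column.  For these, there are [k * (k - 1) / 2] choices
of the gap and of the position, and [two_false_le] bounds what follows. *)
Lemma rest_le k n : 0 < k ->
  2 * rest k n <= 2 * k * rest 1 n + k * k.-1 *
    \sum_(1 <= i < n.+1) \sum_(1 <= j < (n - i).+1) (i + j) * rest 1 (n - i - j).
Proof.
move=> k0; rewrite {1}restE /one_count.
rewrite [X in _ + X](eq_bigr _ (fun i _ => eq_bigr _ (fun j _ => big_split _ _ _ _ _))).
rewrite [X in _ + X](eq_bigr _ (fun i _ => big_split _ _ _ _ _)) /=.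
rewrite big_split /= addnA addnAC mulnDr; apply: leq_add.
  rewrite -mulnA leq_mul2l /= restE /one_count !mulnDr.
  apply: leq_add; first apply: leq_add.
  - by case: (n == 0); rewrite //= ?muln1.
  - rewrite big_distrr /=; apply: leq_sum_nat_r => l /andP[l0 _].
    by rewrite mulnA leq_mul2r; apply/orP; right; nia.
  rewrite big_distrr /=; apply: leq_sum_nat_r => i /andP[i0 i_n].
  rewrite big_distrr /=; apply: leq_sum_nat_r => j /andP[j0 jn].
  rewrite (@big_cat_nat _ _ _ n.+1) //=; try lia.
  rewrite [X in _ + X]big_nat [X in _ + X]big1 ?addn0; last first.
    by move=> g /andP[ng _]; rewrite two_true0 ?muln0 //; lia.
  rewrite addn1 big_distrr /=; apply: leq_sum_nat_r => g /andP[g0 _].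
  rewrite mulnDr; apply: leq_trans (leq_addl _ _).
  by rewrite mulnA leq_mul2r; apply/orP; right; nia.
rewrite !big_distrr /=; apply: leq_sum_nat_r => i /andP[i0 i_n].
rewrite !big_distrr /=; apply: leq_sum_nat_r => j /andP[j0 jn].
apply: (@leq_trans (2 * \sum_(1 <= g < n + k) (k - g) * ((i + j) * rest 1 (n - i - j)))).
  rewrite leq_mul2l /=; apply: leq_sum => g _.
  by rewrite leq_mul2l two_false_le ?orbT //; lia.
by rewrite -big_distrl /= mulnA leq_mul2r gap_sum orbT.
Qed.

(** * Few words start with a two-component column *)

(** [q] is a discrete primitive: [p s / 3 ^ s] is at most
[q (s - 1) / 3 ^ (s - 1) - q s / 3 ^ s], and the sum telescopes. *)
Lemma geometric_weight (R : realFieldType) (p q : nat -> R) :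
  (forall s, 0 <= q s)%R -> (forall s, p s.+1 + q s.+1 <= 3 * q s)%R ->
  forall N, (\sum_(1 <= s < N) p s / 3 ^+ s <= q 0)%R.
Proof.
move=> q0 pq [|N]; first by rewrite big_geq.
suff: (\sum_(1 <= s < N.+1) p s / 3 ^+ s + q N / 3 ^+ N <= q 0)%R.
  by apply: le_trans; rewrite lerDl divr_ge0 // exprn_ge0.
elim: N => [|N IH]; first by rewrite big_geq // add0r expr0 divr1.
rewrite big_nat_recr //=; apply: le_trans IH; rewrite -addrA lerD2l -mulrDl.
rewrite ler_pdivrMr ?exprn_gt0 // exprSr mulrA divfK ?expf_neq0 ?pnatr_eq0 //.
by rewrite mulrC pq.
Qed.

Lemma convolution_le (R : realFieldType) (p q g : nat -> R) (M : R) n :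
  (forall s, 0 <= p s)%R -> (forall s, 0 <= q s)%R ->
  (forall s, p s.+1 + q s.+1 <= 3 * q s)%R -> (0 <= M)%R ->
  (forall s : nat, (0 < s <= n)%N -> 3 ^+ s * g (n - s)%N <= M)%R ->
  (\sum_(1 <= s < n.+1) p s * g (n - s)%N <= q 0 * M)%R.
Proof.
move=> p0 q0 pq M0 gM.
apply: le_trans (ler_wpM2r M0 (geometric_weight _ _ _ q0 pq n.+1)).
rewrite big_distrl /= big_nat [leRHS]big_nat; apply: ler_sum => s s1n.
rewrite -mulrA ler_wpM2l // mulrC ler_pdivlMr ?exprn_gt0 // mulrC.
by apply: gM; lia.
Qed.

Lemma expansion_ge (R : realFieldType) (b : nat -> R) :
  (forall q, 3 * b q <= b q.+1)%R ->
  forall n s, s <= n -> (3 ^+ s * b (n - s)%N <= b n)%R.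
Proof.
move=> b3 n; elim=> [|s IH] sn; first by rewrite expr0 mul1r subn0.
apply: le_trans (IH (ltnW sn)); rewrite exprSr -mulrA ler_wpM2l ?exprn_ge0 //.
by rewrite (_ : n - s = (n - s.+1).+1)%N ?b3 //; lia.
Qed.

Section TwoStart.
Variable R : realFieldType.
Let b (q : nat) : R := (one_start q.+1)%:R%R.

Let b0 q : (0 <= b q)%R. Proof. exact: ler0n. Qed.

Let b3 q : (3 * b q <= b q.+1)%R.
Proof. by rewrite -[3%R]/(3%:R)%R -natrM ler_nat one_start_grows. Qed.

Let bn n s : s <= n -> (3 ^+ s * b (n - s)%N <= b n)%R.
Proof. exact: expansion_ge. Qed.

Let sum_const n : (\sum_(1 <= s < n.+1) b (n - s)%N <= 1 / 2 * b n)%R.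
Proof.
have := convolution_le _ (fun=> 1)%R (fun=> 1 / 2)%R b (b n) n.
under eq_bigr do rewrite mul1r.
by apply=> [?|?|?||s /andP[_ /bn]] //; lra.
Qed.

Let sum_id n : (\sum_(1 <= s < n.+1) s%:R * b (n - s)%N <= 3 / 4 * b n)%R.
Proof.
have := convolution_le _ (fun s => s%:R)%R (fun s => s%:R / 2 + 3 / 4)%R b (b n) n.
rewrite mul0r add0r; apply=> [s|s|s||s /andP[_ /bn //]].
- exact: ler0n.
- by rewrite addr_ge0 ?divr_ge0 ?ler0n.
- by rewrite -natr1; lra.
- exact: b0.
Qed.

Let double_sum n :
  (\sum_(1 <= i < n.+1) \sum_(1 <= j < (n - i).+1)
     (i + j)%:R * b (n - i - j)%N <= 9 / 8 * b n)%R.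
Proof.
(* [i + j <= 2 * i * j], and [s / 3 ^ s] sums up to 3 / 4 *)
apply: (@le_trans _ _ (3 / 2 * \sum_(1 <= i < n.+1) i%:R * b (n - i)%N)%R); last first.
  by have := sum_id n; lra.
rewrite big_distrr /= big_nat [leRHS]big_nat; apply: ler_sum => i /andP[i0 i_n].
apply: (@le_trans _ _ (2 * i%:R * \sum_(1 <= j < (n - i).+1) j%:R * b (n - i - j)%N)%R).
  rewrite big_distrr /= big_nat [leRHS]big_nat; apply: ler_sum => j /andP[j0 jn].
  rewrite mulrA ler_wpM2r // -!natrM ler_nat; nia.
have := sum_id (n - i); have : (0 <= i%:R :> R)%R by [].
nra.
Qed.

Lemma rest_le_one_start l n : 0 < l ->
  (2 * (rest l n)%:R <= (2 * l%:R + 9 / 8 * (l%:R * (l%:R - 1))) * b n)%R.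
Proof.
move=> l0; have := rest_le l n l0.
rewrite -(ler_nat R) natrD !natrM => /le_trans; apply.
rewrite -[l.-1]subn1 natrB // [leRHS]mulrDl; apply: lerD.
  by rewrite ler_wpM2l ?mulr_ge0 ?ler0n // ler_nat rest1_le.
rewrite (mulrC (9 / 8)%R) -[leRHS]mulrA ler_wpM2l //.
  by rewrite mulr_ge0 ?ler0n // subr_ge0 ler1n.
apply: le_trans (double_sum n); rewrite natr_sum; apply: ler_sum => i _.
rewrite natr_sum; apply: ler_sum => j _.
by rewrite natrM ler_wpM2l ?ler0n // ler_nat rest1_le.
Qed.

Let two_weight (l : nat) : R :=
  (l%:R * (l%:R - 1) * (2 * l%:R + 9 / 8 * (l%:R * (l%:R - 1))))%R.

(** [two_weight l] is twice the bound [l * (l - 1) / 2] of [gap_sum] times the one of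
[rest_le_one_start]. *)
Let two_block N s n :
  (4 * (\sum_(1 <= g < N) two_count rest true s g n)%:R <= 465 / 32 * b n)%R.
Proof.
have w0 l : (0 <= two_weight l)%R.
  case: l => [|l]; first by rewrite /two_weight !mul0r.
  rewrite /two_weight -natr1 addrK; have := ler0n R l.
  by move: (l%:R)%R => x x0; rewrite !(mulr_ge0, addr_ge0, invr_ge0).
(* the polynomial solution of [p s.+1 + q s.+1 = 3 * q s]; its value at 0 is
   the sum of [two_weight l / 3 ^ l] *)
have q0 : (forall s, 0 <= 465 / 32 + 129 / 8 * s%:R + 73 / 8 * s%:R ^+ 2 +
    13 / 4 * s%:R ^+ 3 + 9 / 16 * s%:R ^+ 4 :> R)%R.
  move=> x; have x0 := ler0n R x; have x2 := exprn_ge0 2 x0.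
  have x3 := exprn_ge0 3 x0; have x4 := exprn_ge0 4 x0; lra.
have qstep l : (two_weight l.+1 + (465 / 32 + 129 / 8 * l.+1%:R +
    73 / 8 * l.+1%:R ^+ 2 + 13 / 4 * l.+1%:R ^+ 3 + 9 / 16 * l.+1%:R ^+ 4) <=
  3 * (465 / 32 + 129 / 8 * l%:R + 73 / 8 * l%:R ^+ 2 + 13 / 4 * l%:R ^+ 3 +
    9 / 16 * l%:R ^+ 4))%R.
  by rewrite /two_weight -[(l.+1%:R)%R]natr1; lra.
have := convolution_le _ two_weight _ b (b n) n w0 q0 qstep (b0 n).
rewrite !expr0n /= !mulr0 !addr0 => /(_ (fun s h => bn _ _ (proj2 (andP h)))).
apply: le_trans.
have -> : \sum_(1 <= g < N) two_count rest true s g n =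
    \sum_(1 <= l < n.+1) (\sum_(1 <= g < N) (l - g)) * rest l (n - l).
  rewrite /two_count /=; under eq_bigr do rewrite add0n.
  by rewrite exchange_big /=; apply: eq_bigr => l _; rewrite big_distrl.
rewrite natr_sum big_distrr /= big_nat [leRHS]big_nat.
apply: ler_sum => l /andP[l0 _].
have -> : (4 * ((\sum_(1 <= g < N) (l - g)) * rest l (n - l))%:R =
   (2 * \sum_(1 <= g < N) (l - g))%:R * (2 * (rest l (n - l))%:R) :> R)%R.
  by rewrite !natrM; ring.
rewrite -mulrA; apply: ler_pM.
- exact: ler0n.
- by rewrite -natrM ler0n.
- by rewrite -[X in (_ * (_ - X))%R]/(1%:R)%R -natrB // subn1 -natrM ler_nat gap_sum.
- exact: rest_le_one_start.
Qed.

(** The sums over the lengths of the two runs contribute a factor 1 / 2 each, and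
the shift of the index in [b] a factor 3, so that the ratio is at most
3 * 465 / 512. *)
Lemma two_start_le_over n : two_start n <= 3 * one_start n.
Proof.
case: n => [|n]; first by rewrite /two_start big_geq.
suff: (4 * (two_start n.+1)%:R <= 465 / 32 * (1 / 4 * (3 * b n)))%R.
  rewrite /b -(ler_nat R) natrM; have := ler0n R (one_start n.+1); lra.
have inner (i : nat) : (4 * (\sum_(1 <= j < (n.+1 - i).+1) \sum_(1 <= g < n.+2)
    two_count rest true (i + j) g (n.+1 - i - j))%:R <=
  465 / 32 * (1 / 2 * b (n.+1 - i)))%R.
  apply: le_trans (ler_wpM2l _ (sum_const _)); last by lra.
  rewrite natr_sum !big_distrr /=; apply: ler_sum => j _; exact: two_block.
rewrite /two_start natr_sum big_distrr /=.
apply: le_trans (ler_sum _ (fun i _ => inner i)) _.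
rewrite -big_distrr /= -big_distrr /=.
have : (\sum_(1 <= i < n.+2) 1 * b (n.+1 - i)%N <= 1 / 2 * (3 * b n))%R.
  apply: (convolution_le _ _ (fun=> 1 / 2)%R) => [?|?|?||[|s] // /andP[_ sn]].
  - by lra.
  - by lra.
  - by lra.
  - by rewrite mulr_ge0.
  - by rewrite subSS exprS -mulrA ler_wpM2l ?bn.
rewrite (eq_bigr _ (fun i _ => mul1r _)); lra.
Qed.
End TwoStart.

Lemma two_start_le n : two_start n <= 3 * one_start n.
Proof. exact: (two_start_le_over rat). Qed.

(** * Supermultiplicativity and growth of the counting numbers *)

Definition total n := one_start n + two_start n.

Lemma two_start_le_rest k n : 0 < k ->
  two_start n + \sum_(1 <= l < n.+1) rest l (n - l) <= rest k n.
Proof.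
move=> k0; rewrite restE /one_count addnC -addnA; apply: leq_trans (leq_addl _ _).
apply: leq_add.
  apply: leq_sum_nat_r => l /andP[l0 _].
  by rewrite leq_pmull //; lia.
apply: leq_sum_nat_r => i /andP[i0 _]; apply: leq_sum_nat_r => j /andP[j0 _].
apply: (@leq_trans (\sum_(1 <= g < n + k) two_count rest true (i + j) g (n - i - j))).
  by apply: leq_sum_range; lia.
apply: leq_sum_nat_r => g /andP[g0 _].
apply: (@leq_trans ((k - g + (2 * k + (i + j) - 2 * (k - g))) *
  two_count rest true (i + j) g (n - i - j))).
  by rewrite leq_pmull //; lia.
by rewrite mulnDl leq_add2r leq_mul2l two_true_false orbT.
Qed.

Lemma total_le_rest k n : 0 < k -> total n <= rest k n.
Proof. by move=> k0; rewrite /total addnC two_start_le_rest. Qed.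

(** A run fits next to a two-component column in at least four positions, which
compensates the words that do not fit because they start with a two-component
column themselves. *)
Lemma total_le_two s g n : 1 < s -> 0 < g -> total n <= two_count rest false s g n.
Proof.
move=> s1 g0; apply: (@leq_trans (4 * one_start n)).
  by have := two_start_le n; rewrite /total; lia.
rewrite /two_count /=; apply: leq_trans (leq_addl _ _).
rewrite /one_start big_distrr /=; apply: leq_sum_nat_r => l /andP[l0 _].
by rewrite leq_mul2r; apply/orP; right; lia.
Qed.

Lemma geometric_convolution (F : nat) (p : nat -> nat) n :
  (forall s, p s <= 16 ^ s) ->
  F * \sum_(1 <= s < n.+1) p s * (16 * F.+1) ^ (n - s) <= (16 * F.+1) ^ n.
Proof.
move=> p16; suff H : F * \sum_(1 <= s < n.+1) 16 ^ s * (16 * F.+1) ^ (n - s)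
    + 16 ^ n <= (16 * F.+1) ^ n.
  apply: leq_trans H; apply: leq_trans (leq_addr _ _).
  by rewrite leq_mul2l leq_sum ?orbT // => s _; rewrite leq_mul2r p16 orbT.
elim: n => [|n IH]; first by rewrite big_geq // muln0.
rewrite big_nat_recr //= subnn expn0 muln1.
have -> : \sum_(1 <= s < n.+1) 16 ^ s * (16 * F.+1) ^ (n.+1 - s) =
  16 * F.+1 * \sum_(1 <= s < n.+1) 16 ^ s * (16 * F.+1) ^ (n - s).
  rewrite big_distrr /=; apply: eq_big_nat => s /andP[_ sn].
  by rewrite mulnCA -expnS -subSn.
rewrite mulnDr mulnCA expnS [X in _ <= X]expnS; move: (16 ^ n) IH => x IH.
apply: leq_trans (leq_mul (leqnn (16 * F.+1)) IH); nia.
Qed.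

Lemma quartic_le_exp16 l :
  l.+1 * (l * l) <= 16 ^ l /\ (l * l) * (l * l) <= 16 ^ l.
Proof.
have lt_l := ltn_expl l (isT : 1 < 2).
rewrite (_ : 16 = 2 ^ 4) // -expnM (mulnC 4) expnM; move: (2 ^ l) lt_l => x lt_lx.
have sq : l * l <= x * x by rewrite leq_mul // ltnW.
rewrite (_ : x ^ 4 = (x * x) * (x * x)); last by rewrite !expnS expn0 muln1 !mulnA.
split; rewrite leq_mul //.
by rewrite (leq_trans lt_lx) // leq_pmull //; lia.
Qed.

Definition growth := 16 * 101.

(** All factors that are polynomial in the lengths are absorbed by powers of 16, so
that [geometric_convolution] makes each of the nested sums gain a factor 100. *)
Lemma rest_upper k n : 0 < k -> rest k n <= k * k * growth ^ n.
Proof.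
have [N] := ubnP n; elim: N => // N IH in k n *; rewrite ltnS => nN k0.
have [->|n0] := posnP n; first by rewrite rest0 muln1; nia.
have conv p := @geometric_convolution 100 p.
have step (p : nat -> nat) m : m <= n -> 0 < m -> (forall l, p l * (l * l) <= 16 ^ l) ->
    100 * \sum_(1 <= l < m.+1) p l * rest l (m - l) <= growth ^ m.
  move=> mn m0 pl; apply: leq_trans (conv (fun l => p l * (l * l)) m pl).
  rewrite leq_mul2l /=; apply: leq_sum_nat_r => l /andP[l0 lm].
  by rewrite -mulnA leq_mul2l IH ?orbT //; lia.
have T1 : 100 * \sum_(1 <= l < n.+1) (k + l) * rest l (n - l) <= k * growth ^ n.
  apply: (@leq_trans (k * (100 * \sum_(1 <= l < n.+1) l.+1 * rest l (n - l)))).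
    rewrite mulnCA leq_mul2l /= big_distrr /=; apply: leq_sum_nat_r => l /andP[l0 _].
    by rewrite mulnA leq_mul2r; apply/orP; right; nia.
  by rewrite leq_mul2l step ?orbT // => l; case: (quartic_le_exp16 l).
have double : 100 * (100 * \sum_(1 <= i < n.+1) \sum_(1 <= j < (n - i).+1)
    (2 + (i + j)) * growth ^ (n - i - j)) <= growth ^ n.
  apply: leq_trans (conv (fun i => 4 * i) n _) => [|i]; last first.
    by case: i => // i; rewrite expnS leq_mul // ltn_expl.
  rewrite leq_mul2l /= big_distrr /=; apply: leq_sum_nat_r => i /andP[i0 _].
  apply: (@leq_trans (4 * i * (100 * \sum_(1 <= j < (n - i).+1) j * growth ^ (n - i - j)))).
    rewrite mulnCA leq_mul2l /= big_distrr /=; apply: leq_sum_nat_r => j /andP[j0 _].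
    by rewrite mulnA leq_mul2r; apply/orP; right; nia.
  by rewrite leq_mul2l conv ?orbT // => l; rewrite ltnW // ltn_expl.
rewrite restE /one_count eqn0Ngt n0 add0n.
rewrite [X in _ + X](eq_bigr _ (fun i _ => eq_bigr _ (fun j _ => big_split _ _ _ _ _))) /=.
rewrite -(@leq_pmul2l 100) // mulnDr.
apply: leq_trans (leq_add T1 (leqnn _)) _.
suff T2 : \sum_(1 <= i < n.+1) \sum_(1 <= j < (n - i).+1)
   (\sum_(1 <= g < n + k) (k - g) * two_count rest false (i + j) g (n - i - j) +
    \sum_(1 <= g < n + k) (2 * k + (i + j) - 2 * (k - g)) *
       two_count rest true (i + j) g (n - i - j)) <=
   2 * k * k * \sum_(1 <= i < n.+1) \sum_(1 <= j < (n - i).+1)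
    (2 + (i + j)) * growth ^ (n - i - j).
  have := leq_mul (leqnn (k * k)) double.
  move: (growth ^ n) T2 => D; nia.
rewrite big_distrr /=; apply: leq_sum_nat_r => i /andP[i0 i_n].
rewrite big_distrr /=; apply: leq_sum_nat_r => j /andP[j0 jn].
rewrite -(mulnA 2) -mulnA [leqRHS]mul2n -[leqRHS]addnn; apply: leq_add.
  apply: (@leq_trans (\sum_(1 <= g < n + k) (k - g) * ((i + j) * growth ^ (n - i - j)))).
    apply: leq_sum_nat_r => g _; rewrite leq_mul2l; apply/orP; right.
    apply: leq_trans (two_false_le _ _ _ _) _; first lia.
    rewrite leq_mul2l; apply/orP; right.
    by have := IH 1 (n - i - j) ltac:(lia) isT; rewrite !mul1n.
  rewrite -big_distrl /=; have := gap_sum k (n + k).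
  move: (\sum_(_ <= g < _) _) (growth ^ _) => S D; nia.
apply: (@leq_trans (k * (2 + (i + j)) * \sum_(1 <= g < n + k)
    two_count rest true (i + j) g (n - i - j))).
  rewrite big_distrr /=; apply: leq_sum_nat_r => g /andP[g0 _].
  by rewrite leq_mul2r; apply/orP; right; nia.
have -> : \sum_(1 <= g < n + k) two_count rest true (i + j) g (n - i - j) =
    \sum_(1 <= l < (n - i - j).+1) (\sum_(1 <= g < n + k) (l - g)) * rest l (n - i - j - l).
  rewrite /two_count /=; under eq_bigr do rewrite add0n.
  by rewrite exchange_big /=; apply: eq_bigr => l _; rewrite big_distrl.
have [->|m0] := posnP (n - i - j).
  by rewrite big_geq // muln0.
suff : \sum_(1 <= l < (n - i - j).+1) (\sum_(1 <= g < n + k) (l - g)) *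
   rest l (n - i - j - l) <= growth ^ (n - i - j).
  move: (\sum_(_ <= _ < _) _) (growth ^ _) => S D SD.
  by rewrite mulnA leq_mul // leq_mul // leq_pmull.
apply: leq_trans (_ : _ <= 100 * \sum_(1 <= l < (n - i - j).+1) (l * l) * rest l (n - i - j - l)) _.
  apply: leq_trans (leq_pmull _ _) => //.
  apply: leq_sum_nat_r => l /andP[l0 _]; rewrite leq_mul2r; apply/orP; right.
  have := gap_sum l (n + k); nia.
apply: step => // [|l]; first lia.
by case: (quartic_le_exp16 l).
Qed.

Lemma total_upper n : total n <= 4 * growth ^ n.
Proof.
apply: (@leq_trans (4 * one_start n)).
  by have := two_start_le n; rewrite /total; lia.
rewrite leq_mul2l /=.
apply: leq_trans (_ : _ <= 100 * \sum_(1 <= l < n.+1) (l * l) * growth ^ (n - l)) _.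
  apply: leq_trans (leq_pmull _ _) => //.
  by apply: leq_sum_nat_r => l /andP[l0 _]; apply: rest_upper.
apply: geometric_convolution => l.
by case: (quartic_le_exp16 l) => H _; apply: leq_trans H; apply: leq_pmull.
Qed.

(** The terms of [one_count] with runs of at most seven cells, and with
two-component columns whose runs and gap have at most four; each of them
involves [h] at an index between [n - 15] and [n - 1]. *)
Definition short_count (h : nat -> nat -> nat) (k n : nat) : nat :=
  \sum_(1 <= l < 8) (k + l) * h l (n - l) +
  \sum_(1 <= i < 5) \sum_(1 <= j < 5) \sum_(1 <= g < 5)
    ((k - g) * \sum_(1 <= l < 8) (2 * l + (i + j) - (l - g)) * h l (n - (i + j + l)) +
     (2 * k + (i + j) - 2 * (k - g)) *
       \sum_(1 <= l < 8) (l - g) * h l (n - (i + j + l))).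

Lemma short_count_le k n : 15 <= n -> 0 < k -> short_count rest k n <= rest k n.
Proof.
move=> n15 k0; rewrite [leqRHS]restE /one_count -addnA.
apply: leq_trans (leq_addl _ _); apply: leq_add.
  by apply: leq_sum_range; lia.
apply: leq_trans (leq_sum_range _ 1 5 n.+1 _); last lia.
apply: leq_sum_nat_r => i /andP[i0 i5].
apply: leq_trans (leq_sum_range _ 1 5 (n - i).+1 _); last lia.
apply: leq_sum_nat_r => j /andP[j0 j5].
apply: leq_trans (leq_sum_range _ 1 5 (n + k) _); last lia.
apply: leq_sum_nat_r => g /andP[g0 g5].
apply: leq_add; rewrite leq_mul2l; apply/orP; right; apply: leq_trans (leq_addl _ _);
  apply: leq_trans (leq_sum_range _ 1 8 (n - i - j).+1 _); try lia;
  by apply: leq_sum_nat_r => l _; rewrite -!subnDA -addnA.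
Qed.

Lemma short_count_scale (h h' : nat -> nat -> nat) (c c' k n n' : nat) :
  (forall l e, 0 < l < 8 -> 0 < e <= 15 -> c * h l (n - e) <= c' * h' l (n' - e)) ->
  c * short_count h k n <= c' * short_count h' k n'.
Proof.
move=> hh'; rewrite /short_count !mulnDr.
have inner (w : nat -> nat) s : s <= 8 ->
    c * (\sum_(1 <= l < 8) w l * h l (n - (s + l))) <=
    c' * (\sum_(1 <= l < 8) w l * h' l (n' - (s + l))).
  move=> s8; rewrite !big_distrr; apply: leq_sum_nat_r => l /= l8.
  by rewrite !(mulnCA _ (w l)) leq_mul2l hh' ?orbT //; lia.
apply: leq_add; first exact: (inner (addn k) 0).
rewrite !big_distrr; apply: leq_sum_nat_r => i /= /andP[i0 i5].
rewrite !big_distrr; apply: leq_sum_nat_r => j /= /andP[j0 j5].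
rewrite !big_distrr; apply: leq_sum_nat_r => g /= _.
have s8 : i + j <= 8 by lia.
by rewrite !mulnDr leq_add // !(mulnCA c) !(mulnCA c') leq_mul2l inner ?orbT.
Qed.

(** A rounded dominant eigenvector of [short_count] when a cell has weight
10 / 43. *)
Definition profile (l : nat) : nat := nth 0 [:: 0; 13; 20; 29; 40; 54; 68; 82] l.

Definition binary_sum (a b : nat) (f : nat -> N) : N :=
  foldr (fun i s => N.add (f i) s) 0%num (index_iota a b).

Lemma binary_sumE a b (f : nat -> N) :
  N.to_nat (binary_sum a b f) = \sum_(a <= i < b) N.to_nat (f i).
Proof.
rewrite /binary_sum unlock; elim: (index_iota a b) => //= i s <-.
exact: N2Nat.inj_add.
Qed.

Definition binary_short_count (h : nat -> nat -> N) (k n : nat) : N :=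
  N.add (binary_sum 1 8 (fun l => N.mul (N.of_nat (k + l)) (h l (n - l))))
  (binary_sum 1 5 (fun i => binary_sum 1 5 (fun j => binary_sum 1 5 (fun g =>
    N.add
     (N.mul (N.of_nat (k - g)) (binary_sum 1 8 (fun l =>
        N.mul (N.of_nat (2 * l + (i + j) - (l - g))) (h l (n - (i + j + l))))))
     (N.mul (N.of_nat (2 * k + (i + j) - 2 * (k - g))) (binary_sum 1 8 (fun l =>
        N.mul (N.of_nat (l - g)) (h l (n - (i + j + l)))))))))).

Lemma binary_short_countE (h : nat -> nat -> N) k n :
  N.to_nat (binary_short_count h k n) =
  short_count (fun l m => N.to_nat (h l m)) k n.
Proof.
have mulE m x : N.to_nat (N.mul (N.of_nat m) x) = m * N.to_nat x by lia.
have sumE m f : N.to_nat (binary_sum 1 8 (fun l => N.mul (N.of_nat (m l)) (f l))) =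
    \sum_(1 <= l < 8) m l * N.to_nat (f l).
  by rewrite binary_sumE; apply: eq_bigr => l _; rewrite mulE.
rewrite /binary_short_count N2Nat.inj_add sumE; congr addn.
rewrite binary_sumE; apply: eq_bigr => i _.
rewrite binary_sumE; apply: eq_bigr => j _.
rewrite binary_sumE; apply: eq_bigr => g _.
by rewrite N2Nat.inj_add !mulE !sumE.
Qed.

Definition binary_profile (l m : nat) : N :=
  N.mul (N.of_nat (profile l)) (N.mul (N.pow 43 (N.of_nat m)) (N.pow 10 (N.of_nat (15 - m)))).

Lemma binary_profileE l m :
  N.to_nat (binary_profile l m) = profile l * (43 ^ m * 10 ^ (15 - m)).
Proof.
have powE b e : N.to_nat (N.pow b (N.of_nat e)) = N.to_nat b ^ e.
  elim: e => [|e IH]; first by rewrite expn0.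
  by rewrite Nat2N.inj_succ N.pow_succ_r' N2Nat.inj_mul IH expnS.
by rewrite /binary_profile !N2Nat.inj_mul Nat2N.id !powE.
Qed.

(** The inequality for the weights [(10 / 43) ^ e], multiplied by [43 ^ 15]; it is
evaluated in binary. *)
Lemma profile_subinvariant k : 0 < k < 8 ->
  profile k * 43 ^ 15 <=
  short_count (fun l m => profile l * (43 ^ m * 10 ^ (15 - m))) k 15.
Proof.
move=> k8.
have -> : profile k * 43 ^ 15 = N.to_nat (binary_profile k 15).
  by rewrite binary_profileE subnn expn0 muln1.
apply: (@leq_trans (N.to_nat (binary_short_count binary_profile k 15))); last first.
  rewrite binary_short_countE -(mul1n (short_count _ _ _)) -[leqRHS]mul1n.
  by apply: short_count_scale => l e _ _; rewrite !mul1n binary_profileE.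
suff : N.leb (binary_profile k 15) (binary_short_count binary_profile k 15) by lia.
have all_ok : all (fun k =>
    N.leb (binary_profile k 15) (binary_short_count binary_profile k 15)) (index_iota 1 8).
  by vm_compute.
by apply: (allP all_ok); rewrite mem_index_iota.
Qed.

Lemma rest_gt0 k n : 0 < k -> 0 < rest k n.
Proof.
move=> k0; case: n => // n; rewrite restE /one_count /= add0n.
by rewrite big_nat_recr //= subnn rest0 muln1 !addn_gt0 k0 !orbT.
Qed.

(** The constant [82 * 43 ^ 15] takes care of [n < 15], where [rest k n] is only
known to be positive; 82 is the largest entry of [profile]. *)
Lemma rest_lower k n : 0 < k < 8 ->
  profile k * 43 ^ n <= 82 * 43 ^ 15 * (10 ^ n * rest k n).
Proof.
have [N] := ubnP n; elim: N => // N IH in k n *; rewrite ltnS => nN k8.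
have [n15|n15] := ltnP n 15.
  rewrite -[leqLHS]muln1; apply: leq_mul; last first.
    by rewrite muln_gt0 expn_gt0 rest_gt0 //; lia.
  apply: leq_mul; last by rewrite leq_exp2l // ltnW.
  by case: k k8 => [|[|[|[|[|[|[|[|]]]]]]]].
apply: leq_trans (_ : _ <= 82 * 43 ^ 15 * (10 ^ n * short_count rest k n)) _; last first.
  by rewrite !leq_mul2l short_count_le ?orbT //; lia.
rewrite mulnA.
apply: leq_trans (short_count_scale (fun l m => profile l * (43 ^ m * 10 ^ (15 - m)))
  _ (43 ^ (n - 15)) _ _ 15 _ _); last first.
  move=> l e l8 /andP[e0 e15]; have := IH l (n - e) ltac:(lia) l8.
  have -> : 10 ^ n = 10 ^ e * 10 ^ (n - e) by rewrite -expnD subnKC //; lia.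
  have -> : 43 ^ (n - e) = 43 ^ (n - 15) * 43 ^ (15 - e).
    by rewrite -expnD; congr expn; lia.
  rewrite subKn // => /(leq_mul (leqnn (10 ^ e))).
  move: (82 * 43 ^ 15) (10 ^ e) (10 ^ (n - e)) (43 ^ (n - 15)) (43 ^ (15 - e)).
  move: (rest l (n - e)) (profile l) => r p K t c u v; nia.
rewrite -[X in _ * 43 ^ X](subnK n15) expnD mulnCA (mulnC (43 ^ _)).
by rewrite [leqRHS]mulnC leq_mul2r profile_subinvariant ?orbT.
Qed.

Local Open Scope classical_set_scope.
Local Open Scope ring_scope.

Set Implicit Arguments.
Unset Strict Implicit.

(** * Limits of roots of supermultiplicative sequences *)

Definition root_seq (R : realType) (a : nat -> nat) (n : nat) : R :=
  (a n)%:R `^ (n%:R)^-1.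

Lemma supermultiplicative_pow (a : nat -> nat) :
  (forall m n, 0 < m -> 0 < n -> a m * a n <= a (m + n))%N ->
  forall m q r, (0 < m -> 0 < r -> a m ^ q * a r <= a (q * m + r))%N.
Proof.
move=> sup_a m q r m0 r0; elim: q => [|q IH]; first by rewrite mul1n.
rewrite expnS -mulnA; apply: leq_trans (leq_mul (leqnn _) IH) _.
by apply: leq_trans (sup_a _ _ _ _) _ => //; [lia | rewrite mulSn addnA].
Qed.

Lemma powR_inv_cvg1 (R : realType) (x : R) (c : R) :
  0 < x -> x `^ (c / n%:R) @[n --> \oo] --> (1 : R).
Proof.
move=> x0; have xE y : x `^ y = expR (y * ln x).
  by rewrite /powR gt_eqF.
under eq_fun do rewrite xE.
have inv0 : (n%:R^-1 : R) @[n --> \oo] --> (0 : R).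
  apply/gtr0_cvgV0; last exact: cvgr_idn.
  by near=> n; rewrite ltr0n; near: n; exists 1%N.
have : expR (c / n%:R * ln x) @[n --> \oo] --> expR (c * 0 * ln x).
  apply: continuous_cvg; first exact: continuous_expR.
  by apply: cvgMl; apply: cvgMr.
by rewrite mulr0 mul0r expR0.
Unshelve. all: by end_near.
Qed.

Lemma expr_root (R : realType) (x : R) n : 0 <= x -> (0 < n)%N ->
  (x ^+ n) `^ (n%:R)^-1 = x.
Proof.
move=> x0 n0; rewrite -powR_mulrn // -powRrM mulfV ?powRr1 //.
by rewrite pnatr_eq0 -lt0n.
Qed.

Lemma ler_root (R : realType) (x y : R) n : 0 <= x <= y ->
  x `^ (n%:R)^-1 <= y `^ (n%:R)^-1.
Proof.
move=> /andP[x0 xy]; apply: ge0_ler_powR; rewrite ?nnegrE ?invr_ge0 //.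
exact: le_trans xy.
Qed.

Section Fekete.
Variables (R : realType) (a : nat -> nat) (C : nat).
Hypothesis a_super : forall m n, (0 < m -> 0 < n -> a m * a n <= a (m + n))%N.
Hypothesis a_gt0 : forall n, (0 < n -> 0 < a n)%N.
Hypothesis a_upper : forall n, (a n <= C ^ n)%N.

Let u := root_seq R a.
Let S := [set u n | n in [set n | (1 <= n)%N]].

Let bounded : has_ubound S.
Proof.
exists C%:R => _ [n n1 <-]; rewrite /u /root_seq.
by rewrite -[leRHS](@expr_root _ _ n) ?ler_root //= ler0n -natrX ler_nat a_upper.
Qed.

Let has_sup_S : has_sup S.
Proof. by split=> //; exists (u 1), 1%N. Qed.

(** If [n = q * m + r] with [0 < r <= m], then [a n >= a m ^ q], and [q / n] is at
least [(1 - m / n) / m]. *)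
Lemma root_seq_lower m n : (0 < m)%N -> (m < n)%N ->
  u m `^ (1 - m%:R / n%:R) <= u n.
Proof.
move=> m0 mn; have am1 : 1 <= (a m)%:R :> R by rewrite ler1n a_gt0.
have n0 : (0 : R) < n%:R by rewrite ltr0n; lia.
rewrite /u /root_seq -powRrM.
pose q := (n.-1 %/ m)%N; pose r := (n.-1 %% m).+1.
have nE : n = (q * m + r)%N by rewrite /q /r addnS -divn_eq; lia.
have lt_r : (r <= m)%N by rewrite ltn_pmod.
apply: (@le_trans _ _ ((a m)%:R `^ (q%:R / n%:R))).
  apply: ler_powR => //; rewrite mulrBr mulr1 mulrA mulVf ?pnatr_eq0 -?lt0n //.
  rewrite ler_pdivlMr // mulrBl mul1r mulVf ?gt_eqF //.
  rewrite lerBlDr natr1 ler_pdivrMl ?ltr0n // -natrM ler_nat.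
  by rewrite mulnS mulnC [X in (X <= _)%N]nE addnC leq_add2r.
rewrite powRrM powR_mulrn // -natrX ler_root // ler0n ler_nat /=.
apply: leq_trans (_ : a m ^ q * a r <= _)%N; first by rewrite leq_pmulr ?a_gt0.
by rewrite [X in (_ <= a X)%N]nE supermultiplicative_pow.
Qed.

Lemma root_seq_cvg_sup : u n @[n --> \oo] --> sup S.
Proof.
apply/cvgrPdist_le => e e0.
have [_ [m m1 <-] lt_m] := sup_adherent (divr_gt0 e0 (ltr0n R 2)) has_sup_S.
have um0 : 0 < u m by rewrite powR_gt0 // ltr0n a_gt0.
have cvg_m : u m `^ (1 - m%:R / n%:R) @[n --> \oo] --> u m.
  have powD y z : u m `^ (y + z) = u m `^ y * u m `^ z.
    by rewrite powRD // (lt0r_neq0 um0) implybT.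
  under eq_fun do rewrite powD.
  have : u m `^ 1 * u m `^ (- m%:R / n%:R) @[n --> \oo] --> u m `^ 1 * 1.
    by apply: cvgMr; exact: powR_inv_cvg1.
  by under eq_fun do rewrite mulNr; rewrite mulr1 powRr1 ?ltW.
have /cvgrPdist_le/(_ _ (divr_gt0 e0 (ltr0n R 2))) near_m := cvg_m.
near=> n.
have mn : (m < n)%N by near: n; exists m.+1.
have le_S : u n <= sup S by apply: sup_upper_bound => //; exists n => //=; lia.
rewrite ger0_norm ?subr_ge0 // lerBlDr -lerBlDl.
apply: le_trans (root_seq_lower m1 mn).
have : `|u m - u m `^ (1 - m%:R / n%:R)| <= e / 2 by near: n.
move=> /ler_normlP[_]; lra.
Unshelve. all: by end_near.
Qed.

Lemma root_seq_sup_ge (c lam : R) : 0 < c -> 0 < lam ->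
  (forall n, (0 < n)%N -> c * lam ^+ n <= (a n)%:R) -> lam <= sup S.
Proof.
move=> c0 lam0 low.
have cvg_low : c `^ (1 / n%:R) * lam @[n --> \oo] --> lam.
  have : c `^ (1 / n%:R) * lam @[n --> \oo] --> 1 * lam.
    by apply: cvgMl; exact: powR_inv_cvg1.
  by rewrite mul1r.
apply: (ler_cvg_to cvg_low root_seq_cvg_sup).
near=> n.
have n0 : (0 < n)%N by near: n; exists 1%N.
have lamE : lam = (lam ^+ n) `^ (n%:R)^-1 by rewrite expr_root // ltW.
have lamn0 : 0 <= lam ^+ n by rewrite exprn_ge0 // ltW.
rewrite [X in _ * X]lamE div1r -powRM // ?(ltW c0) //.
by apply: ler_root; rewrite low // andbT mulr_ge0 // ltW.
Unshelve. all: by end_near.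
Qed.
End Fekete.

(** * Geometry of the tiling *)

(** The tile centred at the origin, in coordinates where heights are divided by
[sqrt 3]: its three pairs of parallel edges are given by these linear forms. *)
Definition hex (R : realType) (u w : R) : bool :=
  [&& - (1 / 2) <= w <= 1 / 2, -1 <= u + w <= 1 & -1 <= u - w <= 1].

Definition height (R : realType) (p : R * R) : R := p.2 / Num.sqrt 3.

Definition row_height (R : realType) (c : int * int) : R := c.2%:~R + c.1%:~R / 2.

Lemma sqrt3_ge1 (R : realType) : 1 <= Num.sqrt (3 : R).
Proof. by rewrite -[leLHS]sqrtr1 ler_sqrt ?ltr0n // ler1n. Qed.

Lemma sqrt3_gt0 (R : realType) : 0 < Num.sqrt (3 : R).
Proof. exact: lt_le_trans (sqrt3_ge1 R). Qed.

Lemma cellP (R : realType) (c : int * int) (p : R * R) :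
  cell R c p <-> hex (p.1 - 3 / 2 * c.1%:~R) (height p - row_height R c).
Proof.
rewrite /cell /cell_center /= -/(row_height R c).
have s0 := sqrt3_gt0 R; set s := Num.sqrt 3 in s0 *.
have -> : p.2 - s * row_height R c = s * (height p - row_height R c).
  by rewrite mulrBr /height mulrCA mulfV ?mulr1 ?lt0r_neq0.
move: (p.1 - _) (height p - _) => u w.
rewrite normrM (gtr0_norm s0) -[X in _ <= X / 2]mulr1 -[X in _ + _ <= X]mulr1.
rewrite -mulrA -mulrDr !ler_pM2l // mul1r /hex ler_norml.
by case: (ger0P u) => u0; case: (ger0P w) => w0; split=> [[/andP[w1 w2] uw]|
  /and4P[/andP[w1 w2] /andP[uw1 uw2] uw3 uw4]]; [lra|split; lra|lra|split; lra|
  lra|split; lra|lra|split; lra].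
Qed.

Lemma nbhs_hex (R : realType) (p : R * R) (e : R) (S : set (R * R)) : 0 < e ->
  (forall q, `|q.1 - p.1| < e -> `|height q - height p| < e -> S q) -> nbhs p S.
Proof.
move=> e0 eS; apply/nbhs_ballP; exists e => //= q [/= q1 q2].
apply: eS; rewrite distrC //.
rewrite /height -mulrBl normrM (ger0_norm (x := _^-1)) ?invr_ge0 ?(ltW (sqrt3_gt0 R)) //.
apply: le_lt_trans q2; rewrite ler_piMr // invf_le1 ?sqrt3_gt0 //.
exact: sqrt3_ge1.
Qed.

Lemma cell_closed (R : realType) (c : int * int) : closed (cell R c).
Proof.
rewrite -openC openE => p /=; rewrite /setC /= => ncp.
have away (e : R) : 0 < e ->
    (forall u w, `|u - (p.1 - 3 / 2 * c.1%:~R)| < e ->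
       `|w - (height p - row_height R c)| < e -> ~~ hex u w) ->
    nbhs p (~` cell R c).
  move=> e0 H; apply: (nbhs_hex e0) => q q1 q2 /cellP; apply/negP/H.
    by rewrite (_ : _ - _ = q.1 - p.1) //; ring.
  by rewrite (_ : _ - _ = height q - height p) //; ring.
have {ncp} : ~~ hex (p.1 - 3 / 2 * c.1%:~R) (height p - row_height R c).
  by apply/negP => /cellP.
move: (p.1 - _) (height p - _) away => u w away.
have far (f : R) : 0 < f -> (forall u' w', `|u' - u| < f -> `|w' - w| < f ->
   ~~ hex u' w') -> nbhs p (~` cell R c) by exact: away.
rewrite /hex !negb_and -!ltNge => /orP[/orP[h|h]|/orP[/orP[h|h]|/orP[h|h]]].
- apply: (far (- (1 / 2) - w)); first lra.
  move=> u' w'; rewrite !ltr_distl => /andP[? ?] /andP[? ?]; apply/negP => /and3P[]; lra.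
- apply: (far (w - 1 / 2)); first lra.
  move=> u' w'; rewrite !ltr_distl => /andP[? ?] /andP[? ?]; apply/negP => /and3P[]; lra.
- apply: (far ((- 1 - (u + w)) / 2)); first lra.
  move=> u' w'; rewrite !ltr_distl => /andP[? ?] /andP[? ?]; apply/negP => /and3P[]; lra.
- apply: (far ((u + w - 1) / 2)); first lra.
  move=> u' w'; rewrite !ltr_distl => /andP[? ?] /andP[? ?]; apply/negP => /and3P[]; lra.
- apply: (far ((- 1 - (u - w)) / 2)); first lra.
  move=> u' w'; rewrite !ltr_distl => /andP[? ?] /andP[? ?]; apply/negP => /and3P[]; lra.
apply: (far ((u - w - 1) / 2)); first lra.
move=> u' w'; rewrite !ltr_distl => /andP[? ?] /andP[? ?]; apply/negP => /and3P[]; lra.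
Qed.

Definition neighbour (c d : int * int) : bool :=
  [|| (d.1 == c.1) && ((d.2 == c.2 + 1) || (d.2 == c.2 - 1)),
      (d.1 == c.1 + 1) && ((d.2 == c.2) || (d.2 == c.2 - 1)) |
      (d.1 == c.1 - 1) && ((d.2 == c.2) || (d.2 == c.2 + 1))].

Definition cells_connected (P : {fset int * int}) : Prop :=
  forall A : int * int -> bool,
    (forall c d, c \in P -> d \in P -> neighbour c d -> A c = A d) ->
    forall c d, c \in P -> d \in P -> A c = A d.

Lemma neighbour_sym c d : neighbour c d = neighbour d c.
Proof. rewrite /neighbour; lia. Qed.

(** In the hexagonal tiling, tiles that share a vertex also share an edge. *)
Lemma cells_meet (R : realType) (c d : int * int) (p : R * R) :
  cell R c p -> cell R d p -> c = d \/ neighbour c d.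
Proof.
move=> /cellP/and3P[/andP[a1 a2] /andP[a3 a4] /andP[a5 a6]].
move=> /cellP/and3P[/andP[b1 b2] /andP[b3 b4] /andP[b5 b6]].
rewrite /row_height in a1 a2 a3 a4 a5 a6 b1 b2 b3 b4 b5 b6.
have {}H1 : - 2 <= (d.1 - c.1) + 2 * (d.2 - c.2) <= 2.
  by apply/andP; split; rewrite -(ler_int R) ?(rmorphN, rmorphD, rmorphM) /=; lra.
have {}H2 : - 2 <= 2 * (d.1 - c.1) + (d.2 - c.2) <= 2.
  by apply/andP; split; rewrite -(ler_int R) ?(rmorphN, rmorphD, rmorphM) /=; lra.
have {}H3 : - 2 <= (d.1 - c.1) - (d.2 - c.2) <= 2.
  by apply/andP; split; rewrite -(ler_int R) ?(rmorphN, rmorphD, rmorphM) /=; lra.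
case: c d H1 H2 H3 {a1 a2 a3 a4 a5 a6 b1 b2 b3 b4 b5 b6} => [x y] [x' y'] /=.
rewrite /neighbour /= => H1 H2 H3.
have [[->->]|ne] : (x = x' /\ y = y') \/ (x != x') || (y != y') by lia.
  by left.
by right; lia.
Qed.

Lemma height_center (R : realType) (c : int * int) :
  height (cell_center R c) = row_height R c.
Proof.
by rewrite /height /cell_center /= mulrC mulrA mulVf ?mul1r ?lt0r_neq0 ?sqrt3_gt0.
Qed.

Lemma center_interior (R : realType) (P : {fset int * int}) c :
  c \in P -> interior (figure R P) (cell_center R c).
Proof.
move=> cP; apply: (@nbhs_hex _ _ (1 / 4)); first lra.
move=> q q1 q2; exists c => //; apply/cellP.
move: q1 q2; rewrite height_center !ltr_distl /hex /=.
by move=> /andP[? ?] /andP[? ?]; lra.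
Qed.

Lemma figure_closed (R : realType) (P : {fset int * int}) : closed (figure R P).
Proof. by apply: closed_bigcup => // c _; exact: cell_closed. Qed.

(** If a set of tiles is closed under neighbours inside [P], then it and its
complement in [P] cover disjoint closed parts of the figure, each of which
contains interior points. *)
Lemma connected_cells (R : realType) (P : {fset int * int}) :
  connected (interior (figure R P)) -> cells_connected P.
Proof.
move=> conn A adjA.
have figP (Q : {fset int * int}) p : figure R Q p <-> exists2 c, c \in Q & cell R c p.
  by split=> [[c cQ cp]|[c cQ cp]]; exists c.
pose PA b := [fset c in P | A c == b]%fset.
have PAP b c : (c \in PA b) = (c \in P) && (A c == b) by rewrite !inE.
have disj b p : figure R (PA b) p -> figure R (PA (~~ b)) p -> False.
  move=> /figP[c + cp] /figP[d + dp]; rewrite !PAP => /andP[cP /eqP Ac] /andP[dP /eqP Ad].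
  have [cd|cd] := cells_meet cp dp; first by move: Ad; rewrite -cd Ac; case: (b).
  by move: (adjA _ _ cP dP cd); rewrite Ac Ad; case: (b).
have cover b p : figure R P p -> figure R (PA b) p \/ figure R (PA (~~ b)) p.
  move=> /figP[c cP cp].
  have [Ac|Ac] := eqVneq (A c) b; [left|right]; apply/figP; exists c => //; rewrite PAP cP.
    by rewrite Ac eqxx.
  by move: Ac; case: (A c); case: (b).
have part b c : c \in PA b -> interior (figure R P) `<=` figure R (PA b).
  move=> cPA; pose B := interior (figure R P) `&` figure R (PA b).
  suff BE : B = interior (figure R P) by rewrite -BE => p [].
  apply: conn.
  - exists (cell_center R c); split.
      by apply: center_interior; move: cPA; rewrite PAP => /andP[].
    apply: interior_subset; exact: center_interior.
  - exists (~` figure R (PA (~~ b))); first by rewrite openC; exact: figure_closed.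
    apply/seteqP; split=> p [ip]; first by move=> fb; split=> // fnb; exact: disj fb fnb.
    move=> nfb; split=> //; have [//|/nfb//] := cover b p (interior_subset ip).
  - by exists (figure R (PA b)); first exact: figure_closed.
move=> c d cP dP; apply/eqP; rewrite eq_sym; apply/negPn/negP => ne.
have cA : c \in PA (A c) by rewrite PAP cP eqxx.
have /figP[e + ep] := part _ _ cA _ (center_interior R dP).
have dA : d \in PA (~~ A c).
  by rewrite PAP dP; move: ne; case: (A c); case: (A d).
move=> eA; apply: (@disj (A c) (cell_center R d)); first by apply/figP; exists e.
by apply: interior_subset; exact: center_interior.
Qed.

Definition point_on (R : realType) (p q : R * R) (t : R) : R * R :=
  (p.1 + t * (q.1 - p.1), p.2 + t * (q.2 - p.2)).

Lemma height_point_on (R : realType) (p q : R * R) (t : R) :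
  height (point_on p q t) = height p + t * (height q - height p).
Proof. by rewrite /height /=; ring. Qed.

Lemma segment_in_component (R : realType) (X : set (R * R)) (p q : R * R) :
  (forall t, 0 <= t <= 1 -> X (point_on p q t)) -> connected_component X p q.
Proof.
move=> segX; exists (point_on p q @` `[0, 1]).
  split.
  - exists 0; first by rewrite /= in_itv /= lexx ler01.
    by rewrite /point_on !mul0r !addr0; case: (p).
  - by move=> _ [t + <-]; rewrite /= in_itv /=; exact: segX.
  - apply: connected_continuous_connected; first exact: segment_connected.
    have lin (a b : R) : continuous (fun t : R => a + t * b).
      move=> t; apply: cvgD; first exact: cvg_cst.
      by apply: cvgM; [exact: cvg_id | exact: cvg_cst].
    apply: continuous_subspaceT => t; exact: (cvg_pair (lin _ _ t) (lin _ _ t)).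
exists 1; first by rewrite /= in_itv /= lexx ler01.
by rewrite /point_on !mul1r !subrKC; case: (q).
Qed.

(** The segment between the two centres crosses the common edge, which has length
1, at its midpoint, so that a narrow strip around it stays in the two tiles. *)
Lemma neighbour_tube (R : realType) (c d : int * int) (t : R) (q : R * R) :
  neighbour c d -> 0 <= t <= 1 ->
  let p := point_on (cell_center R c) (cell_center R d) t in
  `|q.1 - p.1| < 1 / 10 -> `|height q - height p| < 1 / 10 ->
  cell R c q \/ cell R d q.
Proof.
move=> adj /andP[t0 t1] p; rewrite !ltr_distl {}/p height_point_on !height_center /=.
move=> /andP[q1 q2] /andP[q3 q4].
have step (x y : int) : d.1 = c.1 + x -> d.2 = c.2 + y ->
    (d.1%:~R = c.1%:~R + x%:~R :> R) /\ (d.2%:~R = c.2%:~R + y%:~R :> R).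
  by move=> -> ->; rewrite !rmorphD.
have alt b : (~~ b -> cell R d q) -> (b -> cell R c q) -> cell R c q \/ cell R d q.
  by case: b => h1 h2; [left; apply: h2|right; apply: h1].
pose u := q.1 - 3 / 2 * c.1%:~R; pose w := height q - row_height R c.
move: adj; rewrite /neighbour => /or3P[] /andP[/eqP d1 /orP[] /eqP d2].
- have [e1 e2] := step 0 1 (etrans d1 (esym (addr0 _))) d2.
  apply: (alt (w <= 1 / 2)); rewrite -?ltNge => h; apply/cellP;
  move: h q1 q2 q3 q4; rewrite /w /row_height !e1 !e2 /hex; lra.
- have [e1 e2] := step 0 (-1) (etrans d1 (esym (addr0 _))) d2.
  apply: (alt (- (1 / 2) <= w)); rewrite -?ltNge => h; apply/cellP;
  move: h q1 q2 q3 q4; rewrite /w /row_height !e1 !e2 /hex; lra.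
- have [e1 e2] := step 1 0 d1 (etrans d2 (esym (addr0 _))).
  apply: (alt (u + w <= 1)); rewrite -?ltNge => h; apply/cellP;
  move: h q1 q2 q3 q4; rewrite /u /w /row_height !e1 !e2 /hex; lra.
- have [e1 e2] := step 1 (-1) d1 d2.
  apply: (alt (u - w <= 1)); rewrite -?ltNge => h; apply/cellP;
  move: h q1 q2 q3 q4; rewrite /u /w /row_height !e1 !e2 /hex; lra.
- have [e1 e2] := step (-1) 0 d1 (etrans d2 (esym (addr0 _))).
  apply: (alt (-1 <= u + w)); rewrite -?ltNge => h; apply/cellP;
  move: h q1 q2 q3 q4; rewrite /u /w /row_height !e1 !e2 /hex; lra.
have [e1 e2] := step (-1) 1 d1 d2.
apply: (alt (-1 <= u - w)); rewrite -?ltNge => h; apply/cellP;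
move: h q1 q2 q3 q4; rewrite /u /w /row_height !e1 !e2 /hex; lra.
Qed.

(** The interior is star-shaped around the centres, tile by tile, and
[neighbour_tube] joins the centres of neighbouring tiles. *)
Lemma cells_connected_interior (R : realType) (P : {fset int * int}) :
  P != fset0 -> cells_connected P -> connected (interior (figure R P)).
Proof.
move=> /fset0Pn[c0 c0P] conn; set X := interior (figure R P).
have link c d : c \in P -> d \in P -> neighbour c d ->
    connected_component X (cell_center R c) (cell_center R d).
  move=> cP dP cd; apply: segment_in_component => t t01.
  apply: (@nbhs_hex _ _ (1 / 10)); first lra.
  by move=> q q1 q2; have [cq|dq] := neighbour_tube cd t01 q1 q2; [exists c|exists d].
have star c p : c \in P -> cell R c p -> X p ->
    connected_component X p (cell_center R c).
  move=> cP /cellP cp Xp; apply: segment_in_component => t /andP[t0 t1].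
  have [->|tn0] := eqVneq t 0.
    by rewrite /point_on !mul0r !addr0; case: (p) Xp.
  have {}t0 : 0 < t by rewrite lt_neqAle eq_sym tn0.
  (* at parameter [t], the linear forms of [hex] are at distance at least [t]
     from their bounds, and they move by less than [2 * t / 4] *)
  apply: (@nbhs_hex _ _ (t / 4)); first lra.
  move=> q; rewrite height_point_on height_center !ltr_distl /=.
  move=> /andP[q1 q2] /andP[q3 q4]; exists c => //; apply/cellP.
  move: cp q1 q2 q3 q4; rewrite /hex.
  move: (row_height R c) (height p) (height q) (3 / 2 * c.1%:~R) (p.1) (q.1).
  move=> r hp hq x p1 q1 /and3P[/andP[? ?] /andP[? ?] /andP[? ?]] *.
  by apply/and3P; split; apply/andP; split; nra.
pose A c := `[< connected_component X (cell_center R c0) (cell_center R c) >].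
have AP c : c \in P -> connected_component X (cell_center R c0) (cell_center R c).
  move=> cP; have : A c0 = A c.
    apply: conn => // a b aP bP ab; apply/asboolP/asboolP => H.
      by apply: connected_component_trans H _; apply: link.
    apply: connected_component_trans H _; apply: link => //.
    by rewrite neighbour_sym.
  have A0 : A c0.
    by apply/asboolP; apply: connected_component_refl; apply: center_interior.
  by rewrite A0 => /esym /asboolP.
suff -> : X = connected_component X (cell_center R c0) by exact: component_connected.
apply/seteqP; split => [p Xp|]; last exact: connected_component_sub.
have [c /= cP cp] := interior_subset Xp.
apply: connected_component_trans (AP c cP) _.
by apply: connected_component_sym; apply: star.
Qed.

Lemma polyominoP (R : realType) (P : {fset int * int}) :
  polyomino R P <-> P != fset0 /\ cells_connected P.
Proof.
split=> [] [P0 conn]; split=> //; first exact: connected_cells conn.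
exact: cells_connected_interior.
Qed.

Definition slide (d c : int * int) : int * int := (c.1 + d.1, c.2 + d.2).

Definition slide_cells (d : int * int) (P : {fset int * int}) : {fset int * int} :=
  [fset slide d c | c in P]%fset.

Lemma slide_inj d : injective (slide d).
Proof. by move=> [x y] [x' y'] [/addIr-> /addIr->]. Qed.

Lemma mem_slide_cells d P c : (slide d c \in slide_cells d P) = (c \in P).
Proof. by rewrite mem_imfset //; exact: slide_inj. Qed.

Lemma mem_slide_cellsN d P c : (c \in slide_cells d P) = (slide (- d) c \in P).
Proof.
have cE : c = slide d (slide (- d) c).
  by case: c d => [x y] [x' y']; rewrite /slide /= !subrK.
by rewrite {1}cE mem_slide_cells.
Qed.

Lemma cell_slide (R : realType) (d c : int * int) (p : R * R) :
  cell R (slide d c) (p + cell_center R d) <-> cell R c p.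
Proof.
rewrite !cellP; have -> : height (p + cell_center R d) = height p + row_height R d.
  by rewrite -height_center /height /= mulrDl.
suff -> : (p + cell_center R d).1 - 3 / 2 * (slide d c).1%:~R = p.1 - 3 / 2 * c.1%:~R.
  suff -> : height p + row_height R d - row_height R (slide d c) =
    height p - row_height R c by [].
  by rewrite /row_height /slide /= !rmorphD /=; lra.
by rewrite /slide /cell_center /= rmorphD /=; lra.
Qed.

Lemma figure_slide (R : realType) (d : int * int) (P : {fset int * int}) :
  figure R (slide_cells d P) = [set p + cell_center R d | p in figure R P].
Proof.
apply/seteqP; split=> [p [c /= cP cp]|_ [p [c /= cP cp] <-]].
  exists (p - cell_center R d); last by rewrite subrK.
  exists (slide (- d) c); first by rewrite /= -mem_slide_cellsN.
  rewrite -(cell_slide d) subrK; suff -> : slide d (slide (- d) c) = c by [].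
  by case: (c) (d) => [x y] [x' y']; rewrite /slide /= !subrK.
by exists (slide d c); rewrite /= ?mem_slide_cells ?cell_slide.
Qed.

Lemma center_in_figure (R : realType) (P : {fset int * int}) c :
  figure R P (cell_center R c) <-> c \in P.
Proof.
split=> [[d /= dP /cellP]|cP]; last first.
  by exists c => //; apply/cellP; rewrite height_center !subrr /hex; lra.
rewrite height_center /row_height /= => /and3P[/andP[a1 a2] /andP[a3 a4] /andP[a5 a6]].
have H1 : - 1 <= (d.1 - c.1) + 2 * (d.2 - c.2) <= 1.
  by apply/andP; split; rewrite -(ler_int R) ?(rmorphN, rmorphD, rmorphM) /=; lra.
have H2 : - 1 <= 2 * (d.1 - c.1) + (d.2 - c.2) <= 1.
  by apply/andP; split; rewrite -(ler_int R) ?(rmorphN, rmorphD, rmorphM) /=; lra.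
have H3 : - 1 <= (d.1 - c.1) - (d.2 - c.2) <= 1.
  by apply/andP; split; rewrite -(ler_int R) ?(rmorphN, rmorphD, rmorphM) /=; lra.
suff -> : c = d by [].
case: c d H1 H2 H3 {a1 a2 a3 a4 a5 a6 dP} => [x y] [x' y'] /= H1 H2 H3.
by congr pair; lia.
Qed.

Lemma figure_inj (R : realType) (P Q : {fset int * int}) :
  figure R P = figure R Q -> P = Q.
Proof.
move=> PQ; apply/fsetP => c; apply/idP/idP; rewrite -!(center_in_figure R).
  by rewrite PQ.
by rewrite PQ.
Qed.

Lemma leftmost_cell (P : {fset int * int}) : P != fset0 ->
  exists2 c, c \in P & forall d, d \in P -> c.1 <= d.1.
Proof.
move=> /fset0Pn[c0 c0P].
have [c _ cmin] := @arg_minP _ _ P (FSetSub c0P) xpredT (fun c => (val c).1) isT.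
by exists (val c) => [|d dP]; [exact: valP | exact: (cmin (FSetSub dP))].
Qed.

Lemma leftmost_abscissa (R : realType) (P : {fset int * int}) (c : int * int) (p : R * R) :
  (forall d, d \in P -> c.1 <= d.1) -> figure R P p -> 3 / 2 * c.1%:~R - 1 <= p.1.
Proof.
move=> cmin [d /= /cmin + /cellP/and3P[_ /andP[a3 a4] /andP[a5 a6]]].
by rewrite -(ler_int R); lra.
Qed.

(** The leftmost vertices of a figure are the left corners of the tiles in its first
stack, and a translation maps them to the leftmost vertices of the other
figure. *)
Lemma translatesP (R : realType) (P Q : {fset int * int}) : P != fset0 ->
  translates R P Q <-> exists d, Q = slide_cells d P.
Proof.
move=> P0; split=> [[v QE]|[d ->]]; last first.
  by exists (cell_center R d); exact: figure_slide.
have [c cP cmin] := leftmost_cell P0.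
have Q0 : Q != fset0.
  apply/fset0Pn; have : figure R Q (cell_center R c + v).
    by rewrite QE; exists (cell_center R c) => //; apply/center_in_figure.
  by case=> d dQ _; exists d.
have [c' c'Q c'min] := leftmost_cell Q0.
pose corner (c : int * int) : R * R := ((cell_center R c).1 - 1, (cell_center R c).2).
have height_corner e : height (corner e) = row_height R e by rewrite -height_center.
have cornerP e (S : {fset int * int}) : e \in S -> figure R S (corner e).
  move=> eS; exists e => //; apply/cellP; rewrite height_corner /= /hex.
  by rewrite subrr; lra.
(* the smallest abscissas of both figures differ by [v.1] *)
have v1 : v.1 = 3 / 2 * c'.1%:~R - 3 / 2 * c.1%:~R.
  apply/eqP; rewrite eq_le; apply/andP; split.
    have : figure R Q (corner c') by exact: cornerP.
    rewrite QE => -[p /(leftmost_abscissa cmin) + pv].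
    have -> : p.1 = (corner c').1 - v.1 by rewrite -pv /= addrK.
    by rewrite /=; lra.
  have : figure R Q (corner c + v).
    by rewrite QE; exists (corner c) => //; exact: cornerP.
  by move=> /(leftmost_abscissa c'min) /=; lra.
have [e /= eQ /cellP ecell] : figure R Q (corner c + v).
  by rewrite QE; exists (corner c) => //; exact: cornerP.
have ve : v = cell_center R (e - c).
  move: ecell; have -> : height (corner c + v) = row_height R c + v.2 / Num.sqrt 3.
    by rewrite -height_corner /height /= mulrDl.
  move: (c'min _ eQ); rewrite -(ler_int R) => le_e /= /and3P[/andP[a1 a2] /andP[a3 a4] /andP[a5 a6]].
  have s0 := sqrt3_gt0 R.
  rewrite v1 in a3 a4 a5 a6.
  have e1 : e.1%:~R = c'.1%:~R :> R by lra.
  have e2 : v.2 / Num.sqrt 3 = row_height R e - row_height R c by lra.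
  have {}e2 : v.2 = Num.sqrt 3 * (row_height R e - row_height R c).
    by rewrite -e2 mulrC divfK ?lt0r_neq0.
  rewrite (surjective_pairing v) v1 e2 -e1 /cell_center /row_height /= !rmorphB /=.
  by congr pair; [lra | congr (_ * _); lra].
exists (e - c); apply: (@figure_inj R); rewrite figure_slide QE.
by rewrite ve.
Qed.

(** * Column words and their number *)

Definition has_card (T : eqType) (P : T -> Prop) (N : nat) : Prop :=
  exists s : seq T, [/\ uniq s, size s = N & forall x, x \in s <-> P x].

Lemma has_card_ext (T : eqType) (P Q : T -> Prop) N :
  (forall x, P x <-> Q x) -> has_card P N -> has_card Q N.
Proof. by move=> PQ [s [us ss sP]]; exists s; split=> // x; rewrite -PQ. Qed.

Lemma has_card_le (T : eqType) (P Q : T -> Prop) N M :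
  (forall x, P x -> Q x) -> has_card P N -> has_card Q M -> (N <= M)%N.
Proof.
move=> PQ [s [us <- sP]] [t [_ <- tQ]]; apply: uniq_leq_size => // x /sP /PQ.
by move=> /tQ.
Qed.

Lemma has_card0 (T : eqType) (P : T -> Prop) : (forall x, ~ P x) -> has_card P 0.
Proof. by move=> P0; exists [::]; split=> // x; split=> // /P0. Qed.

Lemma has_card0P (T : eqType) (P : T -> Prop) : has_card P 0 -> forall x, ~ P x.
Proof. by move=> [s [_ /size0nil-> sP]] x /sP. Qed.

Lemma has_card1 (T : eqType) (a : T) : has_card (fun x => x = a) 1.
Proof. by exists [:: a]; split=> // x; rewrite mem_seq1; split=> /eqP. Qed.

Lemma has_cardU (T : eqType) (P Q : T -> Prop) N M :
  (forall x, P x -> ~ Q x) -> has_card P N -> has_card Q M ->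
  has_card (fun x => P x \/ Q x) (N + M).
Proof.
move=> PQ [s [us <- sP]] [t [ut <- tQ]]; exists (s ++ t); split.
- rewrite cat_uniq us ut andbT /=; apply/hasPn => x /tQ Qx.
  by apply/negP => /sP /PQ.
- by rewrite size_cat.
- by move=> x; rewrite mem_cat -sP -tQ; split=> [/orP|/orP].
Qed.

Lemma has_card_image (T U : eqType) (f : T -> U) (P : T -> Prop) N :
  (forall x y, P x -> P y -> f x = f y -> x = y) ->
  has_card P N -> has_card (fun u => exists2 x, P x & u = f x) N.
Proof.
move=> injf [s [us <- sP]]; exists (map f s); split; last 1 first.
- move=> u; split=> [/mapP[x /sP]|[x /sP xs ->]]; first by exists x.
  exact: map_f.
- by rewrite map_inj_in_uniq // => x y /sP Px /sP Py; exact: injf.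
- by rewrite size_map.
Qed.

Lemma has_card_sigma (T U : eqType) (s : seq T) (Q : T -> U -> Prop) (M : T -> nat) :
  uniq s -> (forall x, x \in s -> has_card (Q x) (M x)) ->
  has_card (fun p : T * U => p.1 \in s /\ Q p.1 p.2) (\sum_(x <- s) M x)%N.
Proof.
elim: s => [|x s IH] /=; first by move=> _ _; rewrite big_nil; apply: has_card0 => ? [].
move=> /andP[xs us] Qs; rewrite big_cons.
have Qx : has_card (fun p : T * U => exists2 u, Q x u & p = (x, u)) (M x).
  apply: (@has_card_image _ _ (pair x)) => [u v _ _ []//|].
  by apply: Qs; rewrite mem_head.
have {}IH := IH us (fun y ys => Qs y (mem_behead (s := x :: s) ys)).
apply: has_card_ext (has_cardU _ Qx IH) => [[y u] /=|p [u Qu ->] /= []]; last first.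
  by rewrite (negbTE xs).
rewrite in_cons; split=> [[[v Qv [-> ->]]|[ys Qy]]|[/orP[/eqP->|ys] Qu]].
- by rewrite eqxx.
- by rewrite ys orbT.
- by left; exists u.
- by right.
Qed.

Lemma has_card_sum (U : eqType) (a b : nat) (Q : nat -> U -> Prop) (M : nat -> nat) :
  (forall x y u, Q x u -> Q y u -> x = y) ->
  (forall x, (a <= x < b)%N -> has_card (Q x) (M x)) ->
  has_card (fun u => exists x, (a <= x < b)%N /\ Q x u) (\sum_(a <= x < b) M x)%N.
Proof.
move=> disj QM.
have := @has_card_sigma _ _ (index_iota a b) Q M (iota_uniq _ _).
move=> H; have {}H := H (fun x xs => QM x (etrans (esym (mem_index_iota a b x)) xs)).
apply: has_card_ext (@has_card_image _ _ snd _ _ _ H).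
  move=> u; split=> [[[x v] /= [xs Qx] ->]|[x [xs Qx]]].
    by exists x; rewrite -mem_index_iota.
  by exists (x, u); rewrite //= mem_index_iota.
move=> [x u] [y v] /= [_ Qx] [_ Qy] uv; subst v.
by rewrite (disj _ _ _ Qx Qy).
Qed.

Lemma has_card_cons (T A : eqType) (f : T -> A) (D : T -> Prop) (Q : T -> seq A -> Prop) N M :
  injective f -> has_card D N -> (forall x, D x -> has_card (Q x) M) ->
  has_card (fun w => exists x, D x /\ exists2 v, Q x v & w = f x :: v) (N * M).
Proof.
move=> injf [s [us <- sD]] QM.
have H := @has_card_sigma _ _ s Q (fun=> M) us (fun x xs => QM x (proj1 (sD x) xs)).
rewrite big_const_seq count_predT iter_addn_0 mulnC in H.
apply: has_card_ext (@has_card_image _ _ (fun p => f p.1 :: p.2) _ _ _ H).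
  move=> w; split=> [[[x v] /= [/sD Dx Qv] ->]|[x [/sD xs [v Qv ->]]]].
    by exists x; split=> //; exists v.
  by exists (x, v).
by move=> [x u] [y v] /= _ _ [/injf -> ->].
Qed.

Lemma has_card_itv (lo hi : int) (n : nat) : hi - lo = n%:Z \/ n = 0%N /\ hi <= lo ->
  has_card (fun z => lo <= z < hi) n.
Proof.
move=> hilo; exists [seq lo + m%:Z | m <- iota 0 n]; split.
- by rewrite map_inj_uniq ?iota_uniq // => m m'; lia.
- by rewrite size_map size_iota.
- move=> z; split=> [/mapP[m]|z1]; first by rewrite mem_iota; lia.
  by apply/mapP; exists `|z - lo|%N; rewrite ?mem_iota; lia.
Qed.

(** [One b k] has the rows from [b] to [b + k - 1]; [Two b i g j] has [i] cells from
row [b] on, then a gap of [g] rows, then [j] cells. *)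
Inductive column_shape := One of int & nat | Two of int & nat & nat & nat.

(** The default letter, a column without cells. *)
Notation no_column := (One 0 0).

HB.instance Definition _ := gen_eqMixin column_shape.
HB.instance Definition _ := gen_choiceMixin column_shape.

Definition nondegenerate (c : column_shape) : bool :=
  match c with
  | One _ k => (0 < k)%N
  | Two _ i g j => [&& 0 < i, 0 < g & 0 < j]%N
  end.

Definition shape_area (c : column_shape) : nat :=
  match c with One _ k => k | Two _ i _ j => (i + j)%N end.

Definition is_two (c : column_shape) : bool :=
  if c is Two _ _ _ _ then true else false.

Definition bottom (c : column_shape) : int :=
  match c with One b _ => b | Two b _ _ _ => b end.

(** A run of [k] cells from row [b] on and, in the next stack on the right, a run of
[l] cells from row [b'] on; the right neighbours of [(x, y)] are [(x + 1, y)]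
and [(x + 1, y - 1)]. *)
Definition contact (b : int) (k : nat) (b' : int) (l : nat) : bool :=
  (b' < b + k%:Z) && (b <= b' + l%:Z).

Definition upper_bottom (b : int) (i g : nat) : int := b + i%:Z + g%:Z.

Definition touch_both (c d : column_shape) : bool :=
  match c, d with
  | One b k, Two b' i g j => contact b k b' i && contact b k (upper_bottom b' i g) j
  | Two b i g j, One b' l => contact b i b' l && contact (upper_bottom b i g) j b' l
  | _, _ => false
  end.

Definition touch_some (c d : column_shape) : bool :=
  match c, d with
  | One b k, One b' l => contact b k b' l
  | One b k, Two b' i g j => contact b k b' i || contact b k (upper_bottom b' i g) j
  | Two b i g j, One b' l => contact b i b' l || contact (upper_bottom b i g) j b' l
  | _, _ => false
  end.

(** [w] can follow the column [c]; [pend] means that [c] has two components which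
are not both touched by the column before [c], so that the next one has to touch
both. *)
Fixpoint completes (pend : bool) (c : column_shape) (w : seq column_shape) : bool :=
  if w is d :: w' then
    [&& nondegenerate d, (if pend then touch_both c d else touch_some c d) &
        completes (is_two d && ~~ touch_both c d) d w']
  else ~~ pend.

Definition area (w : seq column_shape) : nat := sumn (map shape_area w).

Definition word (w : seq column_shape) : bool :=
  if w is c :: w' then nondegenerate c && completes (is_two c) c w' else false.

Definition completion (pend : bool) (c : column_shape) (n : nat) (w : seq column_shape) :=
  completes pend c w /\ area w = n.

Lemma completion_cons pend c n d w :
  completion pend c n (d :: w) <->
  [/\ nondegenerate d, (if pend then touch_both c d else touch_some c d),
      (shape_area d <= n)%N &
      completion (is_two d && ~~ touch_both c d) d (n - shape_area d) w].
Proof.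
rewrite /completion /area /=; split=> [[/and3P[d0 cd cw] <-]|[d0 cd dn [cw wn]]].
  by split; rewrite ?leq_addr //; split=> //; rewrite addKn.
by rewrite d0 cd cw wn subnKC.
Qed.

Lemma completion_nil pend c n : completion pend c n [::] <-> ~~ pend && (n == 0%N).
Proof.
by rewrite /completion /=; split=> [[-> <-]//|/andP[-> /eqP->]].
Qed.

Lemma has_card_split (A : eqType) (P : seq A -> Prop) (e : bool) (Q : seq A -> Prop) N :
  (P [::] <-> e) -> (forall a v, P (a :: v) <-> Q (a :: v)) -> ~ Q [::] ->
  has_card Q N -> has_card P (e + N).
Proof.
move=> Pe PQ Q0 QN.
have H : has_card (fun v : seq A => v = [::] /\ e) e.
  case: (e); last by apply: has_card0 => v [].
  by apply: has_card_ext (has_card1 [::]) => v; split=> [->|[]].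
apply: has_card_ext (has_cardU _ H QN) => [[|a v]|v [-> _]//].
  by rewrite Pe; split=> [[[_ //]|/Q0]|] //; left.
by rewrite PQ; split=> [[[]|]|] //; right.
Qed.

(** The rows at which the next run may start form one interval, or two disjoint ones
if the run is shorter than the gap. *)
Lemma two_completion_card pend b i g j n :
  (forall b' l m, (0 < l)%N -> (m < n)%N -> has_card (completion false (One b' l) m) (rest l m)) ->
  (0 < i)%N -> (0 < g)%N -> (0 < j)%N ->
  has_card (completion pend (Two b i g j) n) (two_count rest pend (i + j) g n).
Proof.
move=> IH i0 g0 j0; rewrite /two_count.
pose D l b' := if pend then touch_both (Two b i g j) (One b' l)
  else touch_some (Two b i g j) (One b' l).
pose Q l w := exists b' : int, D l b' /\
  exists2 v, completion false (One b' l) (n - l) v & w = One b' l :: v.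
apply: (@has_card_split _ _ _ (fun w => exists l, (1 <= l < n.+1)%N /\ Q l w)).
- exact: completion_nil.
- move=> d v; rewrite completion_cons; split; last first.
    by move=> [l [/andP[l0 ln] [b' [Db [v' cv [-> ->]]]]]].
  move=> [d0 cd dn cv]; case: d d0 cd dn cv => [b' l|b' i' g' j']; last by case: (pend).
  move=> l0 cd ln cv; exists l; rewrite ltnS ln; split; first by rewrite andbT.
  by exists b'; split=> //; exists v.
- by move=> [l [_ [b' [_ []]]]].
apply: has_card_sum => [l l' w|l /andP[l0 ln]].
  by move=> [b' [_ [v _ ->]]] [b'' [_ [v' _ [_ ->]]]].
apply: has_card_cons => [b' b'' []//||b' _]; last by apply: IH => //; lia.
rewrite /D /touch_both /touch_some /contact /upper_bottom; case: pend {D Q}.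
  apply: has_card_ext (@has_card_itv (b + i%:Z + g%:Z - l%:Z) (b + i%:Z) _ _) => [z|]; lia.
have [gl|lg] := leqP g l.
  apply: has_card_ext (@has_card_itv (b - l%:Z) (b + i%:Z + g%:Z + j%:Z) _ _) => [z|]; lia.
have -> : (2 * l + (i + j) - (l - g) = (l + i) + (l + j))%N by lia.
apply: has_card_ext (has_cardU _ (@has_card_itv (b - l%:Z) (b + i%:Z) _ _)
  (@has_card_itv (b + i%:Z + g%:Z - l%:Z) (b + i%:Z + g%:Z + j%:Z) _ _)) => [z|z||]; lia.
Qed.

(** The positions of a two-component column in which exactly one of its runs is
touched form two intervals, whose ends depend on whether the gap exceeds [k]. *)
Lemma one_completion_card b k n : (0 < k)%N ->
  has_card (completion false (One b k) n) (rest k n).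
Proof.
have [N] := ubnP n; elim: N => // N IH in b k n *; rewrite ltnS => nN k0.
have IH1 b' l m : (0 < l)%N -> (m < n)%N -> has_card (completion false (One b' l) m) (rest l m).
  by move=> l0 mn; apply: IH => //; lia.
have IH2 pend b' i g j m : (0 < i)%N -> (0 < g)%N -> (0 < j)%N -> (m <= n)%N ->
    has_card (completion pend (Two b' i g j) m) (two_count rest pend (i + j) g m).
  by move=> i0 g0 j0 mn; apply: two_completion_card => // b'' l m' l0 m'm; apply: IH1 => //; lia.
rewrite restE /one_count -addnA.
pose Q1 l w := exists b', contact b k b' l /\
  exists2 v, completion false (One b' l) (n - l) v & w = One b' l :: v.
pose D p i g j b' := touch_some (One b k) (Two b' i g j) /\ touch_both (One b k) (Two b' i g j) = ~~ p.
pose Q2 p i g j w := exists b', D p i g j b' /\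
  exists2 v, completion p (Two b' i g j) (n - i - j) v & w = Two b' i g j :: v.
apply: (@has_card_split _ _ _ (fun w => (exists l, (1 <= l < n.+1)%N /\ Q1 l w) \/
   exists i, (1 <= i < n.+1)%N /\ exists j, (1 <= j < (n - i).+1)%N /\
   exists g, (1 <= g < n + k)%N /\ (Q2 false i g j w \/ Q2 true i g j w))).
- exact: completion_nil.
- move=> d v; rewrite completion_cons; split; last first.
    move=> [[l [/andP[l0 ln] [b' [Db [v' cv [-> ->]]]]]]|].
      by split.
    move=> [i [/andP[i0 i_n] [j [/andP[j0 jn] [g [/andP[g0 gn] H]]]]]].
    have {}H : exists p, Q2 p i g j (d :: v) by case: H; eexists; eauto.
    move: H => [p [b' [[Db Dp] [v' cv [-> ->]]]]]; split=> //.
    + by rewrite /= i0 g0 j0.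
    + by rewrite /=; lia.
    + by rewrite Dp negbK /= subnDA.
  move=> [d0 cd dn cv]; case: d d0 cd dn cv => [b' l|b' i g j].
    move=> l0 cd ln cv; left; exists l; rewrite ltnS ln; split; first by rewrite andbT.
    by exists b'; split=> //; exists v.
  rewrite [nondegenerate _]/= [shape_area _]/= => /and3P[i0 g0 j0] cd ijn cv; right.
  exists i; split; first lia.
  exists j; split; first lia.
  rewrite subnDA in cv.
  move: cv; rewrite [is_two _]/= andTb; set p := ~~ _ => cv.
  exists g; split; last first.
    suff : Q2 p i g j (Two b' i g j :: v) by case: (p); [right|left].
    by exists b'; split; [rewrite /D negbK|exists v].
  apply/andP; split=> //; rewrite ltnNge; apply/negP => gnk.
  move: cv; rewrite /p; case: (boolP (touch_both _ _)) => [|_ cv].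
    by rewrite /= /contact /upper_bottom; lia.
  have := IH2 true b' i g j (n - i - j)%N i0 g0 j0 ltac:(lia).
  by rewrite two_true0; [move=> /has_card0P /(_ _ cv)|lia].
- move=> [[l [_ [b' [_ []]]]]|] //.
  by move=> [i [_ [j [_ [g [_ [] [b' [_ []]]]]]]]].
have disj2 p i g j p' i' g' j' w : Q2 p i g j w -> Q2 p' i' g' j' w ->
    [/\ p = p', i = i', g = g' & j = j'].
  move=> [b' [[_ Dp] [v _ ->]]] [b'' [[_ Dp'] [v' _ [bE iE gE jE _]]]].
  by move: Dp; rewrite bE iE gE jE Dp' => /negb_inj.
apply: has_cardU.
- move=> w [l [_ [b' [_ [v _ ->]]]]].
  by move=> [i [_ [j [_ [g [_ [] [b'' [_ [v' _]]]]]]]]].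
- apply: has_card_sum => [l l' w|l /andP[l0 ln]].
    by move=> [b' [_ [v _ ->]]] [b'' [_ [v' _ [_ ->]]]].
  apply: has_card_cons => [b' b'' []//||b' _]; last by apply: IH1 => //; lia.
  apply: has_card_ext (@has_card_itv (b - l%:Z) (b + k%:Z) _ _) => [z|]; rewrite /contact; lia.
apply: has_card_sum => [i i' w|i /andP[i0 i_n]].
  by move=> [j [_ [g [_ [] H]]]] [j' [_ [g' [_ [] H']]]]; case: (disj2 _ _ _ _ _ _ _ _ _ H H').
apply: has_card_sum => [j j' w|j /andP[j0 jn]].
  by move=> [g [_ [] H]] [g' [_ [] H']]; case: (disj2 _ _ _ _ _ _ _ _ _ H H').
apply: has_card_sum => [g g' w|g /andP[g0 gn]].
  by move=> [] H [] H'; case: (disj2 _ _ _ _ _ _ _ _ _ H H').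
have injT : injective (fun b' => Two b' i g j) by move=> b' b'' [].
apply: has_cardU => [w H H'||].
- by case: (disj2 _ _ _ _ _ _ _ _ _ H H').
- apply: has_card_cons => // [|b' _]; last by apply: IH2 => //; lia.
  apply: has_card_ext (@has_card_itv (b - i%:Z) (b + k%:Z - i%:Z - g%:Z) _ _) => [z|];
    rewrite /D /= /contact /upper_bottom; lia.
apply: has_card_cons => // [|b' _]; last by apply: IH2 => //; lia.
have [gk|kg] := leqP g k.
  have -> : (2 * k + (i + j) - 2 * (k - g) = (g + j) + (i + g))%N by lia.
  apply: has_card_ext (has_cardU _ (@has_card_itv (b - i%:Z - g%:Z - j%:Z) (b - i%:Z) _ _)
    (@has_card_itv (b + k%:Z - i%:Z - g%:Z) (b + k%:Z) _ _)) => [z|z||];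
    rewrite /D /= /contact /upper_bottom; lia.
have -> : (2 * k + (i + j) - 2 * (k - g) = (k + j) + (k + i))%N by lia.
apply: has_card_ext (has_cardU _
    (@has_card_itv (b - i%:Z - g%:Z - j%:Z) (b + k%:Z - i%:Z - g%:Z) _ _)
    (@has_card_itv (b - i%:Z) (b + k%:Z) _ _)) => [z|z||];
  rewrite /D /= /contact /upper_bottom; lia.
Qed.

(** The first column starts at row 0, which selects one polyomino in each class of
translates. *)
Definition grounded_word (n : nat) (w : seq column_shape) : Prop :=
  [/\ word w, bottom (head no_column w) = 0 & area w = n].

Lemma grounded_word_card n : has_card (grounded_word n) (total n).
Proof.
rewrite /total -[X in has_card _ X]add0n.
pose Q1 l w := exists u : unit, True /\
  exists2 v, completion false (One 0 l) (n - l) v & w = One 0 l :: v.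
pose Q2 i j g w := exists u : unit, True /\
  exists2 v, completion true (Two 0 i g j) (n - i - j) v & w = Two 0 i g j :: v.
apply: (@has_card_split _ _ false (fun w => (exists l, (1 <= l < n.+1)%N /\ Q1 l w) \/
   exists i, (1 <= i < n.+1)%N /\ exists j, (1 <= j < (n - i).+1)%N /\
   exists g, (1 <= g < n.+1)%N /\ Q2 i j g w)).
- by split=> // -[].
- have two_card i g j m : (0 < i)%N -> (0 < g)%N -> (0 < j)%N ->
      has_card (completion true (Two 0 i g j) m) (two_count rest true (i + j) g m).
    move=> i0 g0 j0; apply: two_completion_card => // b' l m' l0 _.
    exact: one_completion_card.
  move=> c v; split.
    move=> [/= /andP[c0 cv] cb nE]; case: c c0 cv cb nE => [b l|b i g j] /=.
      move=> l0 cv b0 nE; subst b; left; exists l; split; first by rewrite -nE /area /=; lia.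
      by exists tt; split=> //; exists v => //; split=> //; rewrite -nE /area /= addKn.
    move=> /and3P[i0 g0 j0] cv b0 nE; subst b; right.
    have cpl : completion true (Two 0 i g j) (n - i - j) v.
      by split=> //; rewrite -nE /area /= -subnDA addKn.
    have nE' : (n = i + j + area v)%N by rewrite -nE.
    exists i; split; first lia.
    exists j; split; first lia.
    exists g; split; last by exists tt; split=> //; exists v.
    rewrite g0 /= ltnS leqNgt; apply/negP => ng.
    have := two_card i g j (n - i - j)%N i0 g0 j0.
    by rewrite two_true0; [move=> /has_card0P /(_ _ cpl)|lia].
  move=> [[l [/andP[l0 ln] [_ [_ [v' [cv nE] [-> ->]]]]]]|].
    by split; rewrite /= ?l0 // /area /= -/(area v') nE; lia.
  move=> [i [/andP[i0 i_n] [j [/andP[j0 jn] [g [/andP[g0 gn]]]]]]].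
  move=> [_ [_ [v' [cv nE] [-> ->]]]].
  by split; rewrite /= ?i0 ?g0 ?j0 // /area /= -/(area v') nE; lia.
- move=> [[l [_ [u [_ []]]]]|] //.
  by move=> [i [_ [j [_ [g [_ [u [_ []]]]]]]]].
apply: has_cardU.
- move=> w [l [_ [u [_ [v _ ->]]]]].
  by move=> [i [_ [j [_ [g [_ [u' [_ [v' _]]]]]]]]].
- apply: has_card_sum => [l l' w|l /andP[l0 ln]].
    by move=> [u [_ [v _ ->]]] [u' [_ [v' _ []]]].
  rewrite -[rest _ _]mul1n; apply: (@has_card_cons unit) => [[] []//||u _].
    by exists [:: tt]; split=> // -[].
  exact: one_completion_card.
apply: has_card_sum => [i i' w|i /andP[i0 i_n]].
  by move=> [j [_ [g [_ [u [_ [v _ ->]]]]]]] [j' [_ [g' [_ [u' [_ [v' _ []]]]]]]].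
apply: has_card_sum => [j j' w|j /andP[j0 jn]].
  by move=> [g [_ [u [_ [v _ ->]]]]] [g' [_ [u' [_ [v' _ []]]]]].
apply: has_card_sum => [g g' w|g /andP[g0 gn]].
  by move=> [u [_ [v _ ->]]] [u' [_ [v' _ []]]].
rewrite -[two_count _ _ _ _ _]mul1n; apply: (@has_card_cons unit) => [[] []//||u _].
  by exists [:: tt]; split=> // -[].
apply: two_completion_card => // b' l m' l0 _; exact: one_completion_card.
Qed.

Lemma completes_cat pend c w v :
  completes pend c w -> completes false (last c w) v -> completes pend c (w ++ v).
Proof.
elim: w pend c => [|d w IH] pend c /=; first by move=> /negbTE->.
by move=> /and3P[-> -> dw] lv; rewrite IH.
Qed.

Lemma completes_nondegenerate pend c w : completes pend c w -> all nondegenerate w.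
Proof. by elim: w pend c => //= d w IH pend c /and3P[-> _ /IH]. Qed.

Lemma word_nondegenerate w : word w -> all nondegenerate w.
Proof. by case: w => //= c w /andP[-> /completes_nondegenerate]. Qed.

Lemma shape_area_gt0 c : nondegenerate c -> (0 < shape_area c)%N.
Proof. by case: c => //= _ i g j /and3P[i0 _ _]; rewrite addn_gt0 i0. Qed.

Lemma same_area_prefix X Y v v' : all nondegenerate X -> all nondegenerate Y ->
  area X = area Y -> X ++ v = Y ++ v' -> X = Y.
Proof.
elim: X Y => [|c X IH] [|d Y] //=.
- by move=> _ /andP[/shape_area_gt0 d0 _]; rewrite /area /=; lia.
- by move=> /andP[/shape_area_gt0 c0 _] _; rewrite /area /=; lia.
move=> /andP[_ X0] /andP[_ Y0] aE [cd XY]; subst d.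
by rewrite (IH Y) //; move: aE; rewrite /area /= => /addnI.
Qed.

Lemma completion_card_ge c n : nondegenerate c -> (0 < n)%N ->
  exists2 M, has_card (completion false c n) M & (total n <= M)%N.
Proof.
move=> c0 n0; case: c c0 => [b k k0|b i g j /= /and3P[i0 g0 j0]].
  by exists (rest k n); [exact: one_completion_card|exact: total_le_rest].
exists (two_count rest false (i + j) g n); last by apply: total_le_two => //; lia.
by apply: two_completion_card => // b' l m' l0 _; exact: one_completion_card.
Qed.

(** Each word of area [m] has at least [total n] completions of area [n], and it can
be recovered as the prefix of area [m] of the result. *)
Lemma total_supermultiplicative m n : (0 < m)%N -> (0 < n)%N ->
  (total m * total n <= total (m + n))%N.
Proof.
move=> m0 n0; have [s [us <- sP]] := grounded_word_card m.
pose Q w v := completion false (last no_column w) n v.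
have /choice[M MP] (w : seq column_shape) :
    exists M, w \in s -> has_card (Q w) M /\ (total n <= M)%N.
  case: (boolP (w \in s)) => [/sP[w0 _ _]|_]; last by exists 0%N.
  have [|M HM leM] := @completion_card_ge (last no_column w) n _ n0.
    case: w w0 => //= c w /andP[c0 /completes_nondegenerate wn].
    by have /allP := wn; have := mem_last c w; rewrite in_cons => /orP[/eqP->|h H] //; apply: H.
  by exists M.
have H := @has_card_sigma _ _ s Q M us (fun w ws => proj1 (MP w ws)).
have {}H := @has_card_image _ _ (fun p => p.1 ++ p.2) _ _ _ H.
apply: leq_trans (has_card_le _ (H _) (grounded_word_card (m + n))).
- apply: (@leq_trans (\sum_(w <- s) total n)%N).
    by rewrite big_const_seq count_predT iter_addn_0 mulnC.
  by rewrite [leqLHS]big_seq [leqRHS]big_seq; apply: leq_sum => w /MP[].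
- move=> _ [[w v] /= [ws [cv av] ->]].
  have [w0 wb wm] := (sP w).1 ws; case: w ws cv w0 wb wm => //= c w ws cv /andP[c0 cw] wb wm.
  split; rewrite /= ?c0 ?completes_cat //.
  by rewrite -wm -av /area /= map_cat sumn_cat addnA.
move=> [w v] [w' v'] /= [ws _] [w's _] wv.
have [w0 _ wm] := (sP w).1 ws; have [w'0 _ w'm] := (sP w').1 w's.
have ww' : w = w'.
  by apply: same_area_prefix wv; rewrite ?word_nondegenerate // wm w'm.
by move: wv; rewrite ww' => /eqP; rewrite eqseq_cat // eqxx => /eqP->.
Qed.

(** * Words and polyominoes *)

Definition in_run (b : int) (k : nat) (y : int) : bool := b <= y < b + k%:Z.

Definition in_column (c : column_shape) (y : int) : bool :=
  match c with
  | One b k => in_run b k y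
  | Two b i g j => in_run b i y || in_run (upper_bottom b i g) j y
  end.

Definition run_rows (b : int) (k : nat) : seq int := [seq b + m%:Z | m <- iota 0 k].

Definition column_rows (c : column_shape) : seq int :=
  match c with
  | One b k => run_rows b k
  | Two b i g j => run_rows b i ++ run_rows (upper_bottom b i g) j
  end.

Definition word_cells (w : seq column_shape) : {fset int * int} :=
  [fset c in [seq (t%:Z, y) | t <- iota 0 (size w), y <- column_rows (nth no_column w t)]]%fset.

Lemma mem_run_rows b k y : (y \in run_rows b k) = in_run b k y.
Proof.
apply/mapP/idP => [[m]|yb]; first by rewrite mem_iota /in_run; lia.
by exists `|y - b|%N; rewrite ?mem_iota; move: yb; rewrite /in_run; lia.
Qed.

Lemma mem_column_rows c y : (y \in column_rows c) = in_column c y.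
Proof. by case: c => [b k|b i g j]; rewrite /= ?mem_cat !mem_run_rows. Qed.

Lemma column_rows_uniq c : nondegenerate c -> uniq (column_rows c).
Proof.
have run_uniq b k : uniq (run_rows b k).
  by rewrite map_inj_uniq ?iota_uniq // => m m'; lia.
case: c => [b k _|b i g j /and3P[i0 g0 j0]]; first exact: run_uniq.
rewrite /= cat_uniq !run_uniq andbT; apply/hasPn => y /=.
by rewrite !mem_run_rows /in_run /upper_bottom; lia.
Qed.

Lemma mem_word_cells w t y :
  ((t%:Z, y) \in word_cells w) = in_column (nth no_column w t) y.
Proof.
rewrite inE /=; apply/allpairsPdep/idP => [[t' [y' [t'w + [tt' ->]]]]|yt].
  by rewrite mem_column_rows (_ : t = t'); [|lia].
have [tw|wt] := ltnP t (size w); last first.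
  by move: yt; rewrite nth_default //= /in_run; lia.
by exists t, y; rewrite mem_iota mem_column_rows.
Qed.

Lemma word_cells_ge0 w c : c \in word_cells w -> exists t : nat, c.1 = t%:Z.
Proof. by rewrite inE => /allpairsPdep[t [y [_ _ ->]]]; exists t. Qed.

Lemma card_word_cells w : all nondegenerate w -> #|` word_cells w| = area w.
Proof.
move=> w0; rewrite card_fseq undup_id; last first.
  apply: allpairs_uniq_dep; first exact: iota_uniq.
    move=> t; rewrite mem_iota => /andP[_ tw]; apply: column_rows_uniq.
    by apply: (allP w0); rewrite mem_nth.
  by move=> [t y] [t' y'] _ _ /= [-> ->].
rewrite size_allpairs_dep /area; congr sumn.
rewrite -[in RHS](mkseq_nth no_column w) /mkseq -map_comp; apply: eq_map => t /=.
by case: (nth _ _ _) => [b k|b i g j] /=; rewrite ?size_cat !size_map !size_iota.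
Qed.

Lemma neighbour_invariant (P : {fset int * int}) (A : int * int -> bool) :
  (forall x y, (x, y) \in P -> (x, y + 1) \in P -> A (x, y) = A (x, y + 1)) ->
  (forall x y y', (x, y) \in P -> (x + 1, y') \in P -> y' = y \/ y' = y - 1 ->
     A (x, y) = A (x + 1, y')) ->
  forall c d, c \in P -> d \in P -> neighbour c d -> A c = A d.
Proof.
move=> vertical horizontal [x y] [x' y'] cP dP.
rewrite /neighbour /= => /or3P[] /andP[/eqP xE /orP[] /eqP yE]; subst x' y'.
- exact: vertical.
- by rewrite [RHS]vertical ?subrK.
- by apply: horizontal => //; left.
- by apply: horizontal => //; right.
- by rewrite [RHS](horizontal _ _ y) ?subrK //; left.
- by rewrite [RHS](horizontal _ _ y) ?subrK //; right; rewrite addrK.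
Qed.

Lemma contactP b k b' l : (0 < k)%N -> (0 < l)%N ->
  contact b k b' l <->
  exists y y', [/\ in_run b k y, in_run b' l y' & y' = y \/ y' = y - 1].
Proof.
rewrite /contact /in_run => k0 l0; split=> [H|[y [y' [H1 H2 H3]]]]; last by lia.
have [bb'|b'b] := leP b b'; first by exists b', b'; split; [lia|lia|left].
by exists b, (b - 1); split; [lia|lia|right].
Qed.

Lemma touch_someP c d :
  nondegenerate c -> nondegenerate d -> ~~ (is_two c && is_two d) ->
  touch_some c d <->
  exists y y', [/\ in_column c y, in_column d y' & y' = y \/ y' = y - 1].
Proof.
case: c => [b k|b i g j]; case: d => [b' l|b' i' g' j'] //=.
- by move=> k0 l0 _; exact: contactP.
- move=> k0 /and3P[i0 _ j0] _; split=> [/orP[]|].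
  + by move=> /(contactP _ _ k0 i0)[y [y' [? yr ?]]]; exists y, y'; rewrite yr.
  + by move=> /(contactP _ _ k0 j0)[y [y' [? yr ?]]]; exists y, y'; rewrite yr orbT.
  + move=> [y [y' [yc /orP[yd|yd] yy']]]; apply/orP; [left|right].
      by apply/(contactP _ _ k0 i0); exists y, y'.
    by apply/(contactP _ _ k0 j0); exists y, y'.
move=> /and3P[i0 _ j0] l0 _; split=> [/orP[]|].
- by move=> /(contactP _ _ i0 l0)[y [y' [yr ? ?]]]; exists y, y'; rewrite yr.
- by move=> /(contactP _ _ j0 l0)[y [y' [yr ? ?]]]; exists y, y'; rewrite yr orbT.
move=> [y [y' [/orP[yd|yd] yc yy']]]; apply/orP; [left|right].
  by apply/(contactP _ _ i0 l0); exists y, y'.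
by apply/(contactP _ _ j0 l0); exists y, y'.
Qed.

Lemma in_column_bottom c : nondegenerate c -> in_column c (bottom c).
Proof. by case: c => [b k|b i g j] /=; rewrite /in_run; lia. Qed.

Section Invariant.
Variables (P : {fset int * int}) (A : int * int -> bool).
Hypothesis A_inv : forall c d, c \in P -> d \in P -> neighbour c d -> A c = A d.

Definition column_in (x : int) (c : column_shape) :=
  forall y, in_column c y -> (x, y) \in P.

Definition column_constant (x : int) (c : column_shape) :=
  forall y y', in_column c y -> in_column c y' -> A (x, y) = A (x, y').

Lemma run_invariant x b k y :
  (forall y, in_run b k y -> (x, y) \in P) -> in_run b k y -> A (x, y) = A (x, b).
Proof.
move=> runP; rewrite /in_run => yb.
have -> : y = b + `|y - b|%:Z by lia.
have : (`|y - b| < k)%N by lia.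
elim: `|y - b|%N => [|m IH] mk; first by rewrite addr0.
rewrite -IH; last by lia.
apply/esym/A_inv; rewrite ?runP // /in_run ?/neighbour /=; lia.
Qed.

Lemma step_invariant x y y' :
  (x, y) \in P -> (x + 1, y') \in P -> y' = y \/ y' = y - 1 ->
  A (x, y) = A (x + 1, y').
Proof. by move=> yP y'P yy'; apply: A_inv; rewrite // /neighbour /=; lia. Qed.

Lemma contact_invariant x b k b' l :
  (0 < k)%N -> (0 < l)%N ->
  (forall y, in_run b k y -> (x, y) \in P) ->
  (forall y, in_run b' l y -> (x + 1, y) \in P) ->
  contact b k b' l -> A (x, b) = A (x + 1, b').
Proof.
move=> k0 l0 bP b'P /(contactP _ _ k0 l0)[y [y' [yb yb' yy']]].
by rewrite -(run_invariant bP yb) -(run_invariant b'P yb') (@step_invariant x y y') ?bP ?b'P.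
Qed.

Lemma one_constant x b k : column_in x (One b k) -> column_constant x (One b k).
Proof. by move=> cP y y' yc y'c; rewrite (run_invariant cP yc) (run_invariant cP y'c). Qed.

Lemma two_constant x b i g j : column_in x (Two b i g j) ->
  A (x, b) = A (x, upper_bottom b i g) -> column_constant x (Two b i g j).
Proof.
move=> cP lu y y'.
have val z : in_column (Two b i g j) z -> A (x, z) = A (x, b).
  move=> /orP[]; first by apply: run_invariant => z' zr; apply: cP; rewrite /= zr.
  by rewrite lu; apply: run_invariant => z' zr; apply: cP; rewrite /= zr orbT.
by move=> /val -> /val ->.
Qed.

(** Both runs of [c] are joined through the column on the right. *)
Lemma both_constant_left x c d :
  nondegenerate c -> nondegenerate d -> column_in x c -> column_in (x + 1) d ->
  touch_both c d -> column_constant x c.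
Proof.
case: c => [b k|b i g j]; first by move=> _ _ /one_constant.
case: d => [b' l|//] /and3P[i0 _ j0] l0 cP dP /andP[tl tu].
apply: two_constant => //.
rewrite (contact_invariant i0 l0 _ dP tl); last by move=> z zr; apply: cP; rewrite /= zr.
by rewrite (contact_invariant j0 l0 _ dP tu) // => z zr; apply: cP; rewrite /= zr orbT.
Qed.

(** Both runs of [d] are joined through the column on the left. *)
Lemma both_constant_right x c d :
  nondegenerate c -> nondegenerate d -> column_in x c -> column_in (x + 1) d ->
  touch_both c d -> column_constant (x + 1) d.
Proof.
case: d => [b' l|b i g j]; first by move=> _ _ _ /one_constant.
case: c => [b' l|//] l0 /and3P[i0 _ j0] dP cP /andP[tl tu].
apply: two_constant => //.
rewrite -(contact_invariant l0 i0 dP _ tl); last by move=> z zr; apply: cP; rewrite /= zr.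
by rewrite -(contact_invariant l0 j0 dP _ tu) // => z zr; apply: cP; rewrite /= zr orbT.
Qed.

Lemma touch_both_some c d : touch_both c d -> touch_some c d.
Proof.
by case: c => [? ?|? ? ? ?]; case: d => [? ?|? ? ? ?] //= /andP[->].
Qed.

Lemma touch_some_two c d : touch_some c d -> ~~ (is_two c && is_two d).
Proof. by case: c => [? ?|? ? ? ?]; case: d. Qed.

(** By induction on the word: when the column [c] is pending, its two runs are joined
through the next column; any other column is joined to its successor as it is. *)
Lemma completes_constant v (t : nat) c pend :
  nondegenerate c -> completes pend c v ->
  (forall s : nat, column_in (t + s)%N (nth no_column (c :: v) s)) ->
  (~~ pend -> column_constant t c) ->
  forall (s : nat) y, in_column (nth no_column (c :: v) s) y ->
    A ((t + s)%N%:Z, y) = A (t%:Z, bottom c).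
Proof.
elim: v t c pend => [|d v IH] t c pend c0 /=.
  move=> pend0 cP cc [|[|s]] y /=; rewrite ?addn0; try by rewrite /in_run; lia.
  by move=> yc; apply: cc => //; exact: in_column_bottom.
move=> /and3P[d0 touch dv] cP cc.
have tS : (t.+1%:Z = t%:Z + 1)%R by lia.
have cP0 : column_in t c by have := cP 0%N; rewrite addn0.
have dP0 : column_in (t%:Z + 1) d by have := cP 1%N; rewrite addn1 tS.
have some : touch_some c d by move: touch; case: (pend) => // /touch_both_some.
have {touch}cconst : column_constant t c.
  by move: touch cc; case: (pend) => [/both_constant_left H _|_ H]; [exact: H|exact: H].
have rec := IH t.+1 d _ d0 dv _ _.
have {rec} : forall (s : nat) y, in_column (nth no_column (d :: v) s) y ->
    A ((t.+1 + s)%N%:Z, y) = A (t.+1%:Z, bottom d).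
  apply: rec => [s|]; first by have := cP s.+1; rewrite addnS addSn.
  rewrite negb_and negbK tS => /orP[d1|]; last exact: both_constant_right.
  by case: d d1 dP0 {some d0 dv cP} => // b l _; exact: one_constant.
move=> rec.
have [y [y' [yc y'd yy']]] := (touch_someP c0 d0 (touch_some_two some)).1 some.
have link : A (t.+1%:Z, bottom d) = A (t%:Z, bottom c).
  rewrite -(rec 0%N y') // addn0 tS -(@step_invariant t y y') ?cP0 ?dP0 //.
  by apply: cconst => //; exact: in_column_bottom.
move=> [|s] z zs; first by rewrite addn0; apply: cconst => //; exact: in_column_bottom.
by rewrite -link -(rec s z zs) addnS addSn.
Qed.
End Invariant.

Lemma word_cells_connected w : word w -> cells_connected (word_cells w).
Proof.
case: w => // c w /andP[c0 cw]; set P := word_cells _ => A A_inv.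
have cP0 : column_in P 0%:Z c by move=> z zr; rewrite (mem_word_cells _ 0).
have val e : e \in P -> A e = A (0%:Z, bottom c).
  case: e => x y eP; have [t /= xE] := word_cells_ge0 eP; subst x.
  have := @completes_constant _ A A_inv w 0 c _ c0 cw _ _ t y.
  rewrite add0n mem_word_cells in eP *; apply=> //.
    by move=> s z; rewrite add0n mem_word_cells.
  by case: (c) cP0 => // b k H _; exact: (one_constant A_inv H).
by move=> e f /val-> /val->.
Qed.

(** Otherwise the vertical line between two stacks would separate the cells. *)
Lemma cut_touch w t :
  cells_connected (word_cells w) -> all nondegenerate w -> (t.+1 < size w)%N ->
  ~~ (is_two (nth no_column w t) && is_two (nth no_column w t.+1)) ->
  touch_some (nth no_column w t) (nth no_column w t.+1).
Proof.
move=> conn w0 tw two.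
have c0 : nondegenerate (nth no_column w t) by apply: (allP w0); rewrite mem_nth // ltnW.
have d0 : nondegenerate (nth no_column w t.+1) by apply: (allP w0); rewrite mem_nth.
apply/negPn/negP => /negP notouch.
pose A (c : int * int) := c.1 <= t%:Z.
have := conn A _ (t%:Z, bottom (nth no_column w t)) (t.+1%:Z, bottom (nth no_column w t.+1)).
rewrite !mem_word_cells !in_column_bottom // /A /= => H.
suff : (t%:Z <= t%:Z) = (t.+1%:Z <= t%:Z) by lia.
apply: H => //; apply: neighbour_invariant => [x y _ _ //|x y y' + + yy'].
move=> xP x'P /=; have [s /= xE] := word_cells_ge0 xP; subst x.
have [st|st] := eqVneq s t; last by lia.
subst s; case: notouch; apply/(touch_someP c0 d0 two).
exists y, y'; split=> //; first by rewrite -mem_word_cells.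
by rewrite -mem_word_cells (_ : t.+1%:Z = t%:Z + 1) //; lia.
Qed.

(** If no neighbour touches both runs of the column [t], then each side can be
assigned to a run that it does not miss: the left part and the right part are
put on the side of the lower run iff they touch it.  This separates the lower
run from the upper one. *)
Lemma cut_two w t :
  cells_connected (word_cells w) -> all nondegenerate w -> (t < size w)%N ->
  (forall s, ~~ (is_two (nth no_column w s) && is_two (nth no_column w s.+1))) ->
  is_two (nth no_column w t) ->
  ~~ ((0 < t)%N && touch_both (nth no_column w t.-1) (nth no_column w t)) ->
  (t.+1 < size w)%N && touch_both (nth no_column w t) (nth no_column w t.+1).
Proof.
move=> conn w0 tw two ct left_open; apply/negPn/negP => right_open.
case E : (nth no_column w t) ct => [//|b i g j] _.
have /and3P[i0 g0 j0] : nondegenerate (Two b i g j).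
  by rewrite -E; apply: (allP w0); rewrite mem_nth.
pose low (d : column_shape) := if d is One b' l then contact b i b' l else false.
pose low' (d : column_shape) := if d is One b' l then contact b' l b i else false.
pose A (c : int * int) :=
  if c.1 < t%:Z then (0 < t)%N && low' (nth no_column w t.-1)
  else if t%:Z < c.1 then low (nth no_column w t.+1) else c.2 < b + i%:Z.
have := conn A _ (t%:Z, b) (t%:Z, upper_bottom b i g).
rewrite !mem_word_cells E /A /= !ltxx /in_run /upper_bottom => H.
suff : (b < b + i%:Z) = (b + i%:Z + g%:Z < b + i%:Z) by lia.
apply: H; [|lia|lia].
apply: neighbour_invariant => [x y|x y y'] xP x'P.
  move: x'P; have [s /= xE] := word_cells_ge0 xP; subst x.
  have [st|] := eqVneq s t; last by move=> st; case: ltgtP => //; lia.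
  by move: xP; rewrite st ltxx !mem_word_cells E /= /in_run /upper_bottom; lia.
have [s /= xE] := word_cells_ge0 xP; subst x.
have sS : s%:Z + 1 = s.+1%:Z by lia.
move: xP x'P; rewrite sS !mem_word_cells /= => ys y's yy'.
have one u v : is_two v -> ~~ (is_two u && is_two v) -> exists b' l, u = One b' l.
  by case: u => [b' l|//]; [exists b', l|case: v].
have nonempty b' l z : in_run b' l z -> (0 < l)%N by rewrite /in_run; lia.
have [st|st] := eqVneq s.+1 t.
  have t0 : (0 < t)%N by lia.
  have sE : s = t.-1 by lia.
  rewrite st E in y's; rewrite sE in ys.
  have [b' [l cE]] : exists b' l, nth no_column w t.-1 = One b' l.
    by apply: one (two t.-1); rewrite prednK // E.
  rewrite cE in ys; move: left_open y's ys.
  have -> : s%:Z < t%:Z by lia.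
  have -> : (s.+1%:Z < t%:Z) = false by lia.
  have -> : (t%:Z < s.+1%:Z) = false by lia.
  rewrite t0 cE E /= => left_open /orP[] yr yl.
    have -> : contact b' l b i.
      by apply/contactP; rewrite ?(nonempty _ _ _ yl) //; exists y, y'.
    by move: yr; rewrite /in_run; lia.
  have up : contact b' l (upper_bottom b i g) j.
    by apply/contactP; rewrite ?(nonempty _ _ _ yl) //; exists y, y'.
  move: left_open yr; rewrite up andbT => /negbTE->.
  by rewrite /in_run /upper_bottom; lia.
have [{}st|st'] := eqVneq s t.
  rewrite st E in ys; rewrite st in y's *.
  have tw' : (t.+1 < size w)%N.
    rewrite ltnNge; apply/negP => wt; move: y's.
    by rewrite nth_default //= /in_run; lia.
  have [b' [l dE]] : exists b' l, nth no_column w t.+1 = One b' l.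
    by have := two t; rewrite E; case: (nth _ _ t.+1) => // b' l _; exists b', l.
  rewrite dE in y's; move: right_open ys y's.
  have -> : (t.+1%:Z < t%:Z) = false by lia.
  have -> : t%:Z < t.+1%:Z by lia.
  rewrite ltxx tw' dE E /= => right_open /orP[] yl yr.
    have -> : contact b i b' l.
      by apply/contactP; rewrite ?(nonempty _ _ _ yr) //; exists y, y'.
    by move: yl; rewrite /in_run; lia.
  have up : contact (upper_bottom b i g) j b' l.
    by apply/contactP; rewrite ?(nonempty _ _ _ yr) //; exists y, y'.
  move: right_open yl; rewrite up andbT => /negbTE->.
  by rewrite /in_run /upper_bottom; lia.
by rewrite !ltz_nat; case: (ltngtP s t) => //; case: (ltngtP s.+1 t); lia.
Qed.

Lemma connected_word w : w != [::] -> all nondegenerate w ->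
  (forall s, ~~ (is_two (nth no_column w s) && is_two (nth no_column w s.+1))) ->
  cells_connected (word_cells w) -> word w.
Proof.
move=> wn w0 two conn.
suff rec v u c : w = u ++ c :: v ->
    completes (is_two c && ~~ ((0 < size u)%N && touch_both (last no_column u) c)) c v.
  case: w wn w0 {two conn} rec => // c w _ /= /andP[-> _] /(_ w [::] c erefl) /=.
  by rewrite andbT.
elim: v u c => [|d v IH] u c wE; set pend := _ && _.
  apply/negP => /andP[c2 left_open].
  have cE : nth no_column w (size u) = c by rewrite wE nth_cat ltnn subnn.
  have uw : (size u < size w)%N by rewrite wE size_cat /=; lia.
  have := cut_two conn w0 uw two; rewrite cE => /(_ c2).
  have -> : (size u).+1 = size w by rewrite wE size_cat /=; lia.
  rewrite ltnn /= => H; suff : false by []; apply: H.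
  case: (u) left_open wE => //= a u' left_open ->.
  by rewrite -cat_cons nth_cat /= ltnSn (nth_last no_column (a :: u')).
have cE : nth no_column w (size u) = c by rewrite wE nth_cat ltnn subnn.
have dE : nth no_column w (size u).+1 = d.
  by rewrite wE nth_cat ltnNge leqnSn /= subSnn.
have uw : ((size u).+1 < size w)%N by rewrite wE size_cat /=; lia.
have d0 : nondegenerate d by rewrite -dE; apply: (allP w0); rewrite mem_nth.
apply/and3P; split=> //; last first.
  have := IH (rcons u c) d; rewrite cat_rcons => /(_ wE).
  by rewrite size_rcons last_rcons.
case: ifP => [/andP[c2 left_open]|_]; last first.
  by have := cut_touch conn w0 uw (two _); rewrite cE dE.
have := cut_two conn w0 (ltnW uw) two; rewrite cE dE => /(_ c2) H.
suff /andP[] : ((size u).+1 < size w)%N && touch_both c d by [].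
apply: H; case: (u) left_open wE => //= a u' left_open ->.
by rewrite -cat_cons nth_cat /= ltnSn (nth_last no_column (a :: u')).
Qed.

Definition has_shape (P : {fset int * int}) (x : int) (c : column_shape) : Prop :=
  forall y, ((x, y) \in P) = in_column c y.

Lemma componentsP P x r : components P x r <->
  [/\ r.1 <= r.2, forall y, r.1 <= y <= r.2 -> (x, y) \in P,
      (x, r.1 - 1) \notin P & (x, r.2 + 1) \notin P].
Proof.
split=> [[r12 rP r1 r2]|[r12 rP r1 r2]]; split=> //.
- by move=> y /rP[].
- by apply/negP => H; apply: r1.
- by apply/negP => H; apply: r2.
- by move=> y /rP yP; split.
- by move=> [H _]; move: r1; rewrite H.
- by move=> [H _]; move: r2; rewrite H.
Qed.

Lemma components_one P x b k : has_shape P x (One b k) -> (0 < k)%N ->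
  components P x = [set (b, b + k%:Z - 1)].
Proof.
move=> cP k0; apply/seteqP; split=> [[lo hi] /componentsP/=[lohi rP r1 r2]|_ ->].
  have := rP lo; have := rP hi; move: r1 r2.
  rewrite !cP /= /in_run => r1 r2 H1 H2; congr pair; lia.
apply/componentsP; split=> /= [|y||]; rewrite ?cP /= /in_run; lia.
Qed.

Lemma components_two P x b i g j : has_shape P x (Two b i g j) ->
  nondegenerate (Two b i g j) ->
  components P x = [set (b, b + i%:Z - 1); (upper_bottom b i g, upper_bottom b i g + j%:Z - 1)].
Proof.
move=> cP /and3P[i0 g0 j0]; apply/seteqP; split; last first.
  by move=> _ [->|->]; apply/componentsP; split=> /= [|y||]; rewrite ?cP /= /in_run /upper_bottom; lia.
move=> [lo hi] /componentsP/=[lohi rP r1 r2].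
have lo_in := rP lo ltac:(lia); have hi_in := rP hi ltac:(lia).
have gap : ~~ (lo <= b + i%:Z <= hi).
  by apply/negP => /rP; rewrite cP /= /in_run /upper_bottom; lia.
move: r1 r2 lo_in hi_in; rewrite !cP /= /in_run /upper_bottom => r1 r2 lo_in hi_in.
have [?|?] : hi < b + i%:Z \/ b + i%:Z < lo by lia.
  by left; congr pair; lia.
by right; congr pair; lia.
Qed.

Lemma components_none P x : has_shape P x no_column -> components P x = set0.
Proof.
move=> cP; apply/seteqP; split=> // r /componentsP[r12 rP _ _].
by have := rP r.1; rewrite lexx r12 cP /= /in_run => /(_ isT); lia.
Qed.

Lemma one_component_shape P x b k : has_shape P x (One b k) -> (0 < k)%N ->
  one_component_column P x.
Proof. by move=> cP k0; rewrite /one_component_column (components_one cP k0) card_set1. Qed.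

Lemma two_component_shape P x b i g j : has_shape P x (Two b i g j) ->
  nondegenerate (Two b i g j) -> two_component_column P x.
Proof.
move=> cP c0; rewrite /two_component_column (components_two cP c0).
apply/eq_cardSP; exists (b, b + i%:Z - 1); first by left.
rewrite (_ : _ `\ _ = [set (upper_bottom b i g, upper_bottom b i g + j%:Z - 1)]) ?card_set1 //.
apply/seteqP; split=> [r [[->|->]] //|_ ->]; first by case.
split; first by right.
by case; rewrite /upper_bottom; move: c0 => /and3P[]; lia.
Qed.

Lemma two_component_is_two P x c : has_shape P x c -> nondegenerate c \/ c = no_column ->
  two_component_column P x -> is_two c.
Proof.
case: c => [b k|//] cP c0; rewrite /two_component_column => H.
have [k0|k0] := posnP k; last first.
  move: H; rewrite (components_one cP k0) => H.
  by have := card_eq_trans (card_esym card_set1) H; move=> /card_eq_II.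
case: c0 => [|cE]; first by rewrite k0.
rewrite cE in cP; rewrite (components_none cP) in H.
by have /eq_cardSP[? []] := H.
Qed.

(** The nearest rows missing from the finite column, above and below, delimit the
run. *)
Lemma run_around P x y : (x, y) \in P ->
  exists2 r, components P x r & r.1 <= y <= r.2.
Proof.
move=> yP; pose B := (\max_(c <- P) `|c.2|%N)%N.
have PB c : c \in P -> (`|c.2| <= B)%N.
  by move=> cP; exact: (@leq_bigmax_seq _ _ xpredT (fun c : int * int => `|c.2|%N)).
have out z : (B < `|z|)%N -> (x, z) \notin P by move=> Bz; apply/negP => /PB /=; lia.
have down : exists n : nat, (x, y - n%:Z) \notin P by exists (`|y| + B.+1)%N; apply: out; lia.
have up : exists n : nat, (x, y + n%:Z) \notin P by exists (`|y| + B.+1)%N; apply: out; lia.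
case: (ex_minnP down) => m mP mmin; case: (ex_minnP up) => n nP nmin.
have m0 : (0 < m)%N by case: m mP {mmin} => //; rewrite subr0 yP.
have n0 : (0 < n)%N by case: n nP {nmin} => //; rewrite addr0 yP.
exists (y - m%:Z + 1, y + n%:Z - 1); last by rewrite /=; lia.
apply/componentsP; split=> /=; rewrite ?addrK ?subrK //; first by lia.
move=> z zr; apply/negPn/negP => zP.
have [zy|yz] := leP z y.
  by have := mmin `|y - z|%N; rewrite (_ : y - `|y - z|%N%:Z = z) ?zP => [/(_ isT)|]; lia.
by have := nmin `|z - y|%N; rewrite (_ : y + `|z - y|%N%:Z = z) ?zP => [/(_ isT)|]; lia.
Qed.

Lemma shape_of_one P x : one_component_column P x ->
  exists c, [/\ has_shape P x c, nondegenerate c & ~~ is_two c].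
Proof.
move=> /eq_cardSP[r rC]; rewrite II0 card_eq0 => /eqP rest0'.
have only r' : components P x r' -> r' = r.
  move=> r'C; apply: contrapT => ne.
  by have : (components P x `\ r) r' by []; rewrite rest0'.
have [r12 rP _ _] := (componentsP P x r).1 rC.
exists (One r.1 (absz (r.2 - r.1 + 1))); split=> //=; last by lia.
move=> y /=; apply/idP/idP => [/run_around[r' /only->]|]; first by rewrite /in_run; lia.
by rewrite /in_run => yr; apply: rP; lia.
Qed.

Lemma components_apart P x r r' : components P x r -> components P x r' -> r != r' ->
  r.2 + 1 < r'.1 \/ r'.2 + 1 < r.1.
Proof.
move=> /componentsP[a1 a2 a3 a4] /componentsP[b1 b2 b3 b4] ne.
have h1 : ~~ (r.1 <= r'.1 - 1 <= r.2) by apply/negP => /a2; apply/negP.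
have h2 : ~~ (r'.1 <= r.1 - 1 <= r'.2) by apply/negP => /b2; apply/negP.
have h3 : ~~ (r.1 <= r'.2 + 1 <= r.2) by apply/negP => /a2; apply/negP.
have h4 : ~~ (r'.1 <= r.2 + 1 <= r'.2) by apply/negP => /b2; apply/negP.
case: r r' ne a1 b1 h1 h2 h3 h4 {a2 a3 a4 b2 b3 b4} => [lo hi] [lo' hi'] /=.
by rewrite xpair_eqE; lia.
Qed.

Lemma shape_of_two P x : two_component_column P x ->
  exists c, [/\ has_shape P x c, nondegenerate c & is_two c].
Proof.
move=> /eq_cardSP[r rC /eq_cardSP[r' [r'C ne]]]; rewrite II0 card_eq0 => /eqP rest0'.
have only s : components P x s -> s = r \/ s = r'.
  move=> sC; apply: contrapT => /not_orP[sr sr'].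
  by have : ((components P x `\ r) `\ r') s by []; rewrite rest0'.
have {}ne : r != r' by apply/eqP => rr'; apply: ne; rewrite rr'.
wlog lt_rr' : r r' rC r'C only ne {rest0'} / r.2 + 1 < r'.1.
  move=> H; have [] := components_apart rC r'C ne; first exact: H.
  by apply: H => //; [move=> s /only[]; [right|left]|rewrite eq_sym].
have [r12 rP _ _] := (componentsP P x r).1 rC.
have [r'12 r'P _ _] := (componentsP P x r').1 r'C.
pose i : int := r.2 - r.1 + 1; pose g : int := r'.1 - r.2 - 1.
pose j : int := r'.2 - r'.1 + 1.
exists (Two r.1 (absz i) (absz g) (absz j)); rewrite /i /g /j.
split=> //=; last by lia.
move=> y /=; apply/idP/idP => [/run_around[s /only[]->]|].
- by rewrite /in_run; lia.
- by rewrite /in_run /upper_bottom; lia.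
by rewrite /in_run /upper_bottom => /orP[yr|yr]; [apply: rP|apply: r'P]; lia.
Qed.

Lemma word_no_adjacent_two w : word w ->
  forall s, ~~ (is_two (nth no_column w s) && is_two (nth no_column w s.+1)).
Proof.
case: w => // c w /andP[_]; move: (is_two c) => pend.
elim: w c pend => [|d w IH] c pend /=; first by move=> _ [|s]; rewrite /= ?nth_nil ?andbF.
move=> /and3P[_ touch /IH H] [|s]; last exact: H.
by apply: touch_some_two; move: touch; case: (pend) => // /touch_both_some.
Qed.

Lemma word_cells_simple (R : realType) w : word w ->
  simple_two_column_polyomino R (word_cells w).
Proof.
move=> ww; have w0 := word_nondegenerate ww.
have shape (x : int) : exists2 t : nat, has_shape (word_cells w) x (nth no_column w t) &
    (nth no_column w t = no_column \/ x = t%:Z).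
  have [x0|x0] := leP 0 x.
    exists `|x|%N; last by right; lia.
    by move=> y; rewrite (_ : x = `|x|%N%:Z) ?mem_word_cells ?absz_nat //; lia.
  exists (size w); rewrite nth_default //; last by left.
  move=> y; rewrite /= /in_run (_ : _ <= _ < _ = false); last by lia.
  by apply/negP => /word_cells_ge0[t /= xt]; lia.
have nondeg t : nondegenerate (nth no_column w t) \/ nth no_column w t = no_column.
  have [tw|wt] := ltnP t (size w); last by right; rewrite nth_default.
  by left; apply: (allP w0); rewrite mem_nth.
split; first split.
- apply/polyominoP; split; last exact: word_cells_connected.
  case: w ww w0 {shape nondeg} => // c w _ /= /andP[c0 _].
  apply/fset0Pn; exists (0%:Z, bottom c).
  by rewrite mem_word_cells /= in_column_bottom.
- move=> x [[x' y] [yP /= xE]]; subst x'.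
  have [t tP _] := shape x; have := tP y; rewrite yP => /esym yt.
  case: (nondeg t) => [t0|tE]; last by move: yt; rewrite tE /= /in_run; lia.
  case E : (nth no_column w t) tP t0 => [b k|b i g j] tP t0.
    by left; exact: one_component_shape tP t0.
  by right; exact: two_component_shape tP t0.
move=> x [x2 x12]; have [t tP tx] := shape x; have [t' t'P t'x] := shape (x + 1).
have t2 := two_component_is_two tP (nondeg t) x2.
have t'2 := two_component_is_two t'P (nondeg t') x12.
have {}tx : x = t by case: tx => // tE; rewrite tE in t2.
have {}t'x : x + 1 = t' by case: t'x => // tE; rewrite tE in t'2.
have := word_no_adjacent_two ww t; rewrite t2 (_ : t.+1 = t') ?t'2 //; lia.
Qed.

Lemma rightmost_cell (P : {fset int * int}) : P != fset0 ->
  exists2 c, c \in P & forall d, d \in P -> d.1 <= c.1.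
Proof.
move=> /fset0Pn[c0 c0P].
have [c _ cmax] := @arg_maxP _ _ P (FSetSub c0P) xpredT (fun c => (val c).1) isT.
by exists (val c) => [|d dP]; [exact: valP | exact: (cmax (FSetSub dP))].
Qed.

Definition raise (e : int) (c : column_shape) : column_shape :=
  match c with One b k => One (b + e) k | Two b i g j => Two (b + e) i g j end.

Lemma in_column_raise e c y : in_column (raise e c) y = in_column c (y - e).
Proof. by case: c => [b k|b i g j]; rewrite /= /in_run /upper_bottom; lia. Qed.

Lemma nondegenerate_raise e c : nondegenerate (raise e c) = nondegenerate c.
Proof. by case: c. Qed.

Lemma is_two_raise e c : is_two (raise e c) = is_two c.
Proof. by case: c. Qed.

Lemma bottom_raise e c : bottom (raise e c) = bottom c + e.
Proof. by case: c. Qed.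

Lemma cells_connected_unslide d P : cells_connected (slide_cells d P) -> cells_connected P.
Proof.
move=> conn A A_inv c e cP eP.
have slideK c' : slide (- d) (slide d c') = c'.
  by case: c' (d) => [x y] [x' y']; rewrite /slide /= !addrK.
have slideNK c' : slide d (slide (- d) c') = c'.
  by case: c' (d) => [x y] [x' y']; rewrite /slide /= !subrK.
have := conn (A \o slide (- d)) _ (slide d c) (slide d e).
rewrite /= !slideK !mem_slide_cells; apply=> // u v.
rewrite -[u in neighbour u](slideNK u) -[v in neighbour _ v](slideNK v) !mem_slide_cellsN => uP vP uv.
apply: A_inv => //; move: uv; rewrite /neighbour /slide /=; lia.
Qed.

(** The words are read off from the leftmost stack on, with the first column moved
to row 0; a stack without cells in between would disconnect the cells. *)
Lemma simple_word (R : realType) P : simple_two_column_polyomino R P ->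
  exists w d, [/\ word w, bottom (head no_column w) = 0 & P = slide_cells d (word_cells w)].
Proof.
move=> [[/polyominoP[P0 conn] cols] simple].
have /choice[shape shapeP] x : exists c, [/\ has_shape P x c,
    (forall y, (x, y) \in P -> nondegenerate c) & is_two c -> two_component_column P x].
  have [[y yP]|none] := pselect (exists y, (x, y) \in P); last first.
    exists no_column; split=> // y; last by move=> yP; case: none; exists y.
    by rewrite /= /in_run (_ : _ <= _ < _ = false); [apply/negP => yP; case: none; exists y|lia].
  have [|x1|x2] := cols x; first by exists (x, y).
    by have [c [cP c0 c1]] := shape_of_one x1; exists c; split=> // c2; rewrite c2 in c1.
  by have [c [cP c0 c1]] := shape_of_two x2; exists c; split.
have [cl clP clmin] := leftmost_cell P0; have [cr crP crmax] := rightmost_cell P0.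
set x0 := cl.1 in clmin; pose b0 := bottom (shape x0).
pose M := (absz (cr.1 - x0)).+1.
have lr := clmin _ crP.
have filled (t : nat) : (t < M)%N -> exists y, (x0 + t%:Z, y) \in P.
  move=> tM; apply: contrapT => none.
  have := conn (fun c => c.1 < x0 + t%:Z) _ cl cr clP crP.
  have t0 : t != 0%N.
    apply/eqP => t0; apply: none; exists cl.2.
    by rewrite t0 addr0 /x0 -surjective_pairing.
  have -> : cl.1 < x0 + t%:Z by rewrite /x0; lia.
  have -> : (cr.1 < x0 + t%:Z) = false.
    apply/negP => lt_t; move: tM; rewrite /M; lia.
  suff H : forall c d, c \in P -> d \in P -> neighbour c d ->
      (c.1 < x0 + t%:Z) = (d.1 < x0 + t%:Z) by move=> /(_ H).
  move=> [x y] [x' y'] cP dP; rewrite /neighbour /=.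
  have nx : x != x0 + t%:Z by apply/eqP => xE; apply: none; exists y; rewrite -xE.
  have nx' : x' != x0 + t%:Z by apply/eqP => xE; apply: none; exists y'; rewrite -xE.
  lia.
pose w := mkseq (fun t => raise (- b0) (shape (x0 + t%:Z))) M.
have nth_w t : (t < M)%N -> nth no_column w t = raise (- b0) (shape (x0 + t%:Z)).
  by move=> tM; rewrite nth_mkseq.
have sw : size w = M by rewrite size_mkseq.
have w0 : all nondegenerate w.
  apply/(all_nthP no_column) => t; rewrite sw => tM; rewrite nth_w // nondegenerate_raise.
  by have [y yP] := filled _ tM; have [_ /(_ _ yP)] := shapeP (x0 + t%:Z).
have PE : P = slide_cells (x0, b0) (word_cells w).
  apply/fsetP => -[x y]; rewrite mem_slide_cellsN /slide /=.
  have [xx0|xx0] := leP x0 x; last first.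
    transitivity false; first by apply/negP => /clmin /=; lia.
    by apply/esym/negP => /word_cells_ge0[t /=]; lia.
  have tE : x - x0 = (absz (x - x0))%:Z by lia.
  rewrite tE mem_word_cells.
  have [tM|tM] := ltnP (absz (x - x0)) M.
    rewrite nth_w // in_column_raise opprK subrK -tE addrCA subrr addr0.
    by have [] := shapeP x.
  rewrite nth_default ?sw //= /in_run (_ : _ <= _ < _ = false); last by lia.
  apply/negP => yP; have xr : (x : int) <= cr.1 := crmax _ yP.
  by move: tM; rewrite /M; lia.
exists w, (x0, b0); split=> //.
  apply: connected_word => //.
  - move=> t; have [tM|tM] := ltnP t.+1 M; last by rewrite (nth_default _ (n := t.+1)) ?sw ?andbF.
    rewrite !nth_w ?(ltnW tM) // !is_two_raise; apply/negP => /andP[t2 t12].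
    apply: (simple (x0 + t%:Z)); have [_ _ H] := shapeP (x0 + t%:Z).
    have [_ _ H'] := shapeP (x0 + t.+1%:Z); split; first exact: H.
    by rewrite -addrA (_ : t%:Z + 1 = t.+1%:Z); [exact: H'|lia].
  - by apply: (@cells_connected_unslide (x0, b0)); rewrite -PE.
by rewrite -nth0 nth_w // addr0 bottom_raise subrr.
Qed.

Lemma bottom_le c y : in_column c y -> nondegenerate c -> bottom c <= y.
Proof. by case: c => [b k|b i g j]; rewrite /= /in_run /upper_bottom; lia. Qed.

(** The lowest row, then the ends of the runs, are where membership changes. *)
Lemma shape_inj c d : nondegenerate c -> nondegenerate d ->
  in_column c =1 in_column d -> c = d.
Proof.
move=> c0 d0 cd.
have bE : bottom c = bottom d.
  apply/eqP; rewrite eq_le !bottom_le // ?cd ?in_column_bottom //.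
  by rewrite -cd in_column_bottom.
case: c d c0 d0 cd bE => [b k|b i g j] [b' k'|b' i' g' j'] /= c0 d0 cd bE; subst b'.
- by congr One; have := cd (b + k%:Z); have := cd (b + k'%:Z); rewrite /= /in_run; lia.
- have := cd (b + i'%:Z); have := cd (upper_bottom b i' g').
  by have := cd b; rewrite /= /in_run /upper_bottom; lia.
- have := cd (b + i%:Z); have := cd (upper_bottom b i g).
  by have := cd b; rewrite /= /in_run /upper_bottom; lia.
have iE : i = i'.
  by have := cd (b + i%:Z); have := cd (b + i'%:Z); rewrite /= /in_run /upper_bottom; lia.
subst i'; have gE : g = g'.
  have := cd (upper_bottom b i g); have := cd (upper_bottom b i g').
  by rewrite /= /in_run /upper_bottom; lia.
subst g'; congr Two.
have := cd (upper_bottom b i g + j%:Z); have := cd (upper_bottom b i g + j'%:Z).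
by rewrite /= /in_run /upper_bottom; lia.
Qed.

Lemma word_cells_inj w w' d : word w -> word w' ->
  bottom (head no_column w) = 0 -> bottom (head no_column w') = 0 ->
  word_cells w' = slide_cells d (word_cells w) -> w = w'.
Proof.
move=> ww ww' wb w'b E.
have w0 := word_nondegenerate ww; have w'0 := word_nondegenerate ww'.
have cell0 v : word v -> bottom (head no_column v) = 0 -> (0%:Z, 0) \in word_cells v.
  case: v => // c v /andP[c0 _] /= b0; rewrite mem_word_cells /=.
  by rewrite -b0 in_column_bottom.
have mem t y : in_column (nth no_column w' t) y = ((t%:Z - d.1, y - d.2) \in word_cells w).
  by rewrite -mem_word_cells E mem_slide_cellsN.
have d1 : d.1 = 0.
  have := cell0 _ ww' w'b; rewrite mem_word_cells mem => /word_cells_ge0[t /= tE].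
  have := cell0 _ ww wb; rewrite -(mem_slide_cells d) -E => /word_cells_ge0[t' /= t'E].
  lia.
have {}mem t y : in_column (nth no_column w' t) y = in_column (nth no_column w t) (y - d.2).
  by rewrite mem d1 subr0 mem_word_cells.
have d2 : d.2 = 0.
  have nd v : word v -> nondegenerate (nth no_column v 0) by case: v => // c v /andP[].
  have H1 : in_column (nth no_column w' 0) 0 by rewrite -mem_word_cells cell0.
  have H2 : in_column (nth no_column w 0) 0 by rewrite -mem_word_cells cell0.
  have := bottom_le (y := d.2) (c := nth no_column w' 0).
  rewrite mem subrr => /(_ H2 (nd _ ww')); rewrite nth0 w'b => le1.
  move: H1; rewrite mem => /bottom_le /(_ (nd _ ww)); rewrite nth0 wb; lia.
have {}mem t : in_column (nth no_column w' t) =1 in_column (nth no_column w t).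
  by move=> y; rewrite mem d2 subr0.
have nonempty v t : all nondegenerate v -> (t < size v)%N ->
    exists y, in_column (nth no_column v t) y.
  by move=> v0 tv; exists (bottom (nth no_column v t)); rewrite in_column_bottom // (allP v0) // mem_nth.
have nothing v t y : in_column (nth no_column v t) y -> (t < size v)%N.
  by rewrite ltnNge => yt; apply/negP => vt; move: yt; rewrite nth_default //= /in_run; lia.
have sE : size w = size w'.
  apply/eqP; rewrite eqn_leq; apply/andP; split; rewrite leqNgt; apply/negP.
    by move=> /(nonempty _ _ w0)[y]; rewrite -mem => /nothing; rewrite ltnn.
  by move=> /(nonempty _ _ w'0)[y]; rewrite mem => /nothing; rewrite ltnn.
apply: (@eq_from_nth _ no_column) => // t tw.
apply: shape_inj; [|by apply: (allP w'0); rewrite mem_nth // -sE|by move=> y; rewrite mem].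
by apply: (allP w0); rewrite mem_nth.
Qed.

Lemma card_slide_cells d P : #|` slide_cells d P| = #|` P|.
Proof. by rewrite card_imfset //; exact: slide_inj. Qed.

Lemma slide_cellsD d e P : slide_cells d (slide_cells e P) = slide_cells (d + e) P.
Proof.
apply/fsetP => -[x y]; rewrite !mem_slide_cellsN /slide /=.
by rewrite !opprD !addrA.
Qed.

Lemma translates_slide (R : realType) d P : P != fset0 ->
  translates R (slide_cells d P) = translates R P.
Proof.
move=> P0; have dP0 : slide_cells d P != fset0.
  by rewrite -cardfs_gt0 card_slide_cells cardfs_gt0.
apply/seteqP; split=> Q /translatesP; [move=> /(_ dP0)|move=> /(_ P0)] => -[e ->].
  by apply/(translatesP _ _ P0); exists (e + d); exact: slide_cellsD.
by apply/(translatesP _ _ dP0); exists (e - d); rewrite slide_cellsD subrK.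
Qed.

Lemma nb_simple_two_columnE (R : realType) n : nb_simple_two_column R n = total n.
Proof.
have [s [us <- sP]] := grounded_word_card n.
pose f w := translates R (word_cells w).
have nonempty w : w \in s -> word_cells w != fset0.
  by move=> /sP[/(word_cells_simple R)[[[]]]].
have f_inj : {in s &, injective f}.
  move=> w w' ws w's fE; have [ww wb _] := (sP w).1 ws; have [ww' w'b _] := (sP w').1 w's.
  have : f w (word_cells w').
    rewrite fE; apply/(translatesP _ _ (nonempty _ w's)); exists (0, 0).
    by apply/fsetP => -[x y]; rewrite mem_slide_cellsN /slide /= !subr0.
  move=> /(translatesP _ _ (nonempty _ ws))[d]; exact: word_cells_inj.
have classesE : simple_two_column_classes R n = [set` [fset f w | w in s]%fset].
  apply/seteqP; split=> [_ [P [Psimple Pn] <-]|_ /imfsetP[w /= ws ->]].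
    have [w [d [ww wb PE]]] := simple_word Psimple.
    have ws : w \in s.
      apply/sP; split=> //; rewrite -card_word_cells ?word_nondegenerate //.
      by rewrite -Pn PE card_slide_cells.
    apply/imfsetP; exists w => //; rewrite /f.
    by rewrite PE translates_slide // nonempty.
  have [ww wb wn] := (sP w).1 ws; exists (word_cells w) => //; split.
    exact: word_cells_simple.
  by rewrite card_word_cells ?word_nondegenerate.
rewrite /nb_simple_two_column classesE set_fsetK card_in_imfset //=.
by rewrite undup_id.
Qed.

Unset Implicit Arguments.
Set Strict Implicit.

(** * The growth constant *)

Lemma total_gt0 n : (0 < n)%N -> (0 < total n)%N.
Proof.
case: n => // n _; apply: leq_trans (leq_addr _ _).
by rewrite /one_start big_nat_recl // subn1 addn_gt0 rest_gt0.
Qed.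

Lemma total_root_bound n : (total n <= (4 * growth) ^ n)%N.
Proof.
case: n => [|n]; first by rewrite /total /one_start /two_start !big_geq.
apply: leq_trans (total_upper n.+1) _.
by rewrite expnMn leq_mul2r -[X in (X <= _)%N]expn1 leq_exp2l ?orbT.
Qed.

Lemma total_lower (R : realType) : exists2 c : R, 0 < c &
  forall n, (0 < n)%N -> c * (43 / 10) ^+ n <= (total n)%:R.
Proof.
pose K := (82 * 43 ^ 15 * 43)%N.
have K0 : (0 < K)%N by rewrite /K muln_gt0 muln_gt0 expn_gt0.
exists (K%:R)^-1; first by rewrite invr_gt0 ltr0n.
case=> // n _; rewrite mulrC ler_pdivrMr ?ltr0n // expr_div_n ler_pdivrMr ?exprn_gt0 ?ltr0n //.
rewrite -!natrX -!natrM ler_nat.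
have low : (43 ^ n <= 82 * 43 ^ 15 * (10 ^ n * rest 1 n))%N.
  by apply: leq_trans (rest_lower 1 n isT); rewrite leq_pmull.
have start : (rest 1 n <= total n.+1)%N.
  exact: leq_trans (rest1_le n) (leq_addr _ _).
apply: (@leq_trans (43 * (82 * 43 ^ 15 * (10 ^ n * total n.+1)))%N).
  rewrite expnS leq_mul2l /=; apply: leq_trans low _.
  by rewrite !leq_mul2l start !orbT.
rewrite /K; move: (82 * 43 ^ 15)%N (total n.+1) => x y; rewrite expnS; nia.
Qed.

Theorem mainTheorem2 (R : realType) :
  exists mu : R,
    [/\ (nth_root_count R n @[n --> \oo] --> mu),
        mu = sup [set nth_root_count R n | n in [set n | (1 <= n)%N]] &
        4 + 294 / 10 ^+ 3 + 676 / 10 ^+ 6 < mu].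
Proof.
have rootE : nth_root_count R = root_seq R total.
  by apply/funext => n; rewrite /nth_root_count nb_simple_two_columnE.
rewrite rootE.
exists (sup [set root_seq R total n | n in [set n | (1 <= n)%N]]); split=> //.
  exact: root_seq_cvg_sup total_supermultiplicative total_gt0 total_root_bound.
have [c c0 low] := total_lower R.
have lam0 : 0 < 43 / 10 :> R by lra.
have := root_seq_sup_ge total_supermultiplicative total_gt0 total_root_bound c0 lam0 low.
by apply: lt_le_trans; lra.
Qed.
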